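(* Let $L>0$, $\mu>0$, $g>0$, $k_0,k_1\in\mathbb{R}$ and $\Omega=2\pi L\mathbb{T}\times(0,1)$. Suppose $\bar\rho=\bar\rho(y)\in C^\infty([0,1])$ satisfies $\inf_{y\in(0,1)}\bar\rho>0$ and $\bar\rho'(y_0)>0$ for some $y_0\in(0,1)$. Then the steady state $(\bar\rho,0,\bar p)$ is linearly unstable; precisely, there exists an exponentially growing solution $(\varrho,\mathbf{u},q)$, $\mathbf u=(u_1,u_2)$, of the linearized perturbed problem $$\varrho_t+\bar\rho' u_2=0,\qquad \bar\rho\,\mathbf{u}_t+\nabla q+\varrho g\mathbf{e}_2=\mu\Delta\mathbf{u},\qquad \operatorname{div}\mathbf{u}=0\quad\text{in }\Omega,$$ with boundary conditions $$u_2=0\ \text{on }\Sigma_1\cup\Sigma_0,\qquad \partial_y u_1=\tfrac{k_1}{\mu}u_1\ \text{on }\Sigma_1,\qquad \partial_y u_1=-\tfrac{k_0}{\mu}u_1\ \text{on }\Sigma_0,$$ such that $\|(\varrho,\mathbf{u},q)(t)\|_{H^k(\Omega)}\to\infty$ as $t\to\infty$, for every integer $k\ge 0$.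
   Context: $2\pi L\mathbb{T}$ is the one-dimensional torus of length $2\pi L$; points of $\Omega$ are written $(x,y)$; $\Sigma_1=2\pi L\mathbb{T}\times\{1\}$, $\Sigma_0=2\pi L\mathbb{T}\times\{0\}$; $\mathbf{e}_2=(0,1)$. The constants $k_0,k_1$ are the Navier-slip coefficients on $\Sigma_0,\Sigma_1$ and have no prescribed sign. The steady pressure $\bar p$ is determined by $\nabla\bar p=-\bar\rho g\mathbf{e}_2$; $(\bar\rho,0,\bar p)$ is a steady state of the nonhomogeneous incompressible Navier-Stokes equations $\rho_t+\mathbf v\cdot\nabla\rho=0$, $\rho\mathbf v_t+\rho\mathbf v\cdot\nabla\mathbf v+\nabla p=\mu\Delta\mathbf v-\rho g\mathbf e_2$, $\operatorname{div}\mathbf v=0$. ''Exponentially growing solution'' means a solution of the form $(\varrho,\mathbf u,q)(x,y,t)=e^{\lambda t}(\tilde\rho,\tilde{\mathbf v},\tilde p)(x,y)$ with a constant $\lambda>0$. *)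

(* Defs.v *)
From Stdlib Require Import Reals.
From Coquelicot Require Import Coquelicot.
Open Scope R_scope.

(* A function on the domain (2 pi L T) x (0,1) is a map [f x y] on R x R,
   2 pi L-periodic in x, of which only the values at 0 < y < 1 are used.
   Boundary values are traces, i.e. limits from inside the strip. *)

(* C^oo([0,1]): all derivatives exist on (0,1) and extend continuously to
   [0,1]; the values of [f] outside (0,1) are irrelevant. *)
Definition smooth_closed_interval (f : R -> R) : Prop :=
  forall n : nat,
    (forall y, 0 < y < 1 -> ex_derive_n f n y) /\
    (exists l : R, filterlim (Derive_n f n) (at_right 0) (locally l)) /\
    (exists l : R, filterlim (Derive_n f n) (at_left 1) (locally l)).

Definition has_trace (f : R -> R -> R) (x y l : R) : Prop :=
  filterlim (fun p : R * R => f (fst p) (snd p))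
    (within (fun p : R * R => 0 < snd p < 1) (locally (x, y)))
    (locally l).

Definition x_periodic (L : R) (f : R -> R -> R) : Prop :=
  forall x y, 0 < y < 1 -> f (x + 2 * PI * L) y = f x y.

(* C^oo of the closed domain.  [ex_diff_n f n x y] covers the iterated partial
   derivatives up to order n in every order of differentiation; once they are
   all continuous, those of [partial_derive] exhaust them. *)
Definition smooth_closed_strip (L : R) (f : R -> R -> R) : Prop :=
  x_periodic L f /\
  (forall (n : nat) (x y : R), 0 < y < 1 -> ex_diff_n f n x y) /\
  (forall (m n : nat) (x y : R), 0 <= y <= 1 ->
     exists l : R, has_trace (partial_derive m n f) x y l).

Definition d_x (f : R -> R -> R) : R -> R -> R := partial_derive 1 0 f.
Definition d_y (f : R -> R -> R) : R -> R -> R := partial_derive 0 1 f.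
Definition laplacian (f : R -> R -> R) (x y : R) : R :=
  partial_derive 2 0 f x y + partial_derive 0 2 f x y.

Definition integral_strip (L : R) (f : R -> R -> R) : R :=
  RInt (fun x => RInt (fun y => f x y) 0 1) 0 (2 * PI * L).

(* On [smooth_closed_strip] functions the integrands extend continuously to the
   closed strip, so these Riemann integrals are the Lebesgue ones and the
   classical derivatives are the weak ones. *)
Definition Hk_norm_sq (L : R) (k : nat) (f : R -> R -> R) : R :=
  sum_n (fun m => sum_n (fun n =>
    integral_strip L (fun x y => (partial_derive m n f x y) ^ 2)) (k - m)) k.

Definition Hk_norm (L : R) (k : nat) (rho u1 u2 q : R -> R -> R) : R :=
  sqrt (Hk_norm_sq L k rho + Hk_norm_sq L k u1
        + Hk_norm_sq L k u2 + Hk_norm_sq L k q).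

Record linearized_solution (L mu g k0 k1 : R) (rhobar : R -> R)
    (rho u1 u2 q : R -> R -> R -> R) : Prop := {
  ls_smooth : forall t, 0 < t ->
    smooth_closed_strip L (rho t) /\ smooth_closed_strip L (u1 t) /\
    smooth_closed_strip L (u2 t) /\ smooth_closed_strip L (q t);
  ls_time : forall t x y, 0 < t -> 0 < y < 1 ->
    ex_derive (fun s => rho s x y) t /\
    ex_derive (fun s => u1 s x y) t /\
    ex_derive (fun s => u2 s x y) t;
  ls_mass : forall t x y, 0 < t -> 0 < y < 1 ->
    Derive (fun s => rho s x y) t + Derive rhobar y * u2 t x y = 0;
  ls_momentum1 : forall t x y, 0 < t -> 0 < y < 1 ->
    rhobar y * Derive (fun s => u1 s x y) t + d_x (q t) x y
    = mu * laplacian (u1 t) x y;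
  ls_momentum2 : forall t x y, 0 < t -> 0 < y < 1 ->
    rhobar y * Derive (fun s => u2 s x y) t + d_y (q t) x y + rho t x y * g
    = mu * laplacian (u2 t) x y;
  ls_div : forall t x y, 0 < t -> 0 < y < 1 ->
    d_x (u1 t) x y + d_y (u2 t) x y = 0;
  ls_impermeable : forall t x, 0 < t ->
    has_trace (u2 t) x 1 0 /\ has_trace (u2 t) x 0 0;
  ls_slip_top : forall t x, 0 < t ->
    has_trace (fun x y => d_y (u1 t) x y - k1 / mu * u1 t x y) x 1 0;
  ls_slip_bottom : forall t x, 0 < t ->
    has_trace (fun x y => d_y (u1 t) x y - (- (k0 / mu)) * u1 t x y) x 0 0
}.

(* The pressure is determined only up to a function of time, and
   (0, 0, e^(lambda t)) solves the problem.  Zero mean of the pressure excludes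
   this spurious growth: a growing solution then has a nonzero velocity. *)
Definition zero_mean (L : R) (f : R -> R -> R) : Prop :=
  integral_strip L f = 0.

Definition exp_mode (lambda : R) (f : R -> R -> R) : R -> R -> R -> R :=
  fun t x y => exp (lambda * t) * f x y.

(* Main.v *)
(* Separating variables with wave number k = 1/L, u_2 = phi(y) cos(k x), an
   exponent lambda is admissible iff phi solves a fourth-order boundary value
   problem, the Euler equation of the quadratic form
     Q_lambda(phi) = lambda^2 A(phi) + lambda B(phi) - g k^2 int rhobar' phi^2,
   with A the kinetic energy and B the viscous and slip contribution.
   Q_lambda is nonnegative for large lambda, and for small lambda it is negative
   on a bump supported where rhobar' > 0.  Let lambda be the supremum of the
   rates at which Q takes a negative value; then Q_lambda >= 0.  If the boundary
   value problem had only the zero solution at lambda, shooting would give a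
   bounded inverse on L^2; by Cauchy-Schwarz for Q_lambda and a Garding
   inequality Q_lambda would be coercive in H^2, hence Q nonnegative slightly
   below lambda, a contradiction.  No compactness is needed. *)

Require Import Defs.
From Stdlib Require Import FunctionalExtensionality Classical_Prop.
From Stdlib Require Import Reals Lra Lia Psatz.
From Coquelicot Require Import Coquelicot.
Open Scope R_scope.

(** * Continuous functions, integrals and Picard iteration *)

(** The slip coefficients have no sign, so B may be indefinite, Q_lambda need not be monotone in
    lambda, and the unstable rates need not form an interval. The supremum still suffices: the
    argument takes from it only nonnegativity of the form there and negative values at rates
    arbitrarily close to it. For large lambda the term lambda^2 A wins because B is bounded below by
    a multiple of - int phi'^2, once half of the viscous term has absorbed the cross term. The
    boundary part of B is rewritten as the integral of a total derivative, so a test function is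
    just a C^2 function vanishing at both ends, and the slip condition is natural. The form is never
    minimised: the contradiction compares integrals of continuous functions, and the mode itself
    comes from a vanishing shooting determinant. All profiles live on the whole line, so integrals
    and two-sided derivatives carry no endpoint clauses; equations and bounds are asked for on [0,1]
    only. *)

Definition cont (f : R -> R) : Prop := forall x, continuous f x.

Lemma cont_const (c : R) : cont (fun _ => c).
Proof. intros x; apply continuous_const. Qed.

Lemma cont_id : cont (fun x => x).
Proof. intros x; apply continuous_id. Qed.

Lemma cont_plus (f h : R -> R) : cont f -> cont h -> cont (fun x => f x + h x).
Proof. intros Hf Hh x; apply (continuous_plus f h x); auto. Qed.

Lemma cont_opp (f : R -> R) : cont f -> cont (fun x => - f x).
Proof. intros Hf x; apply (continuous_opp f x); auto. Qed.

Lemma cont_minus (f h : R -> R) : cont f -> cont h -> cont (fun x => f x - h x).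
Proof. intros Hf Hh x; apply (continuous_minus f h x); auto. Qed.

Lemma cont_mult (f h : R -> R) : cont f -> cont h -> cont (fun x => f x * h x).
Proof. intros Hf Hh x; apply (continuous_mult f h x); auto. Qed.

Lemma cont_pow (f : R -> R) (n : nat) : cont f -> cont (fun x => f x ^ n).
Proof.
intros Hf; induction n as [|n IH]; simpl; [apply cont_const | now apply cont_mult].
Qed.

Lemma cont_comp (f h : R -> R) : cont f -> cont h -> cont (fun x => h (f x)).
Proof. intros Hf Hh x; apply (continuous_comp f h x); auto. Qed.

Lemma cont_abs : cont Rabs.
Proof. intros x; apply continuous_Rabs. Qed.

Lemma cont_derive (f f' : R -> R) : (forall x, is_derive f x (f' x)) -> cont f.
Proof. intros H x; apply (ex_derive_continuous f x); now exists (f' x). Qed.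

Lemma is_derive_eq (f : R -> R) (x l l' : R) :
  is_derive f x l -> l = l' -> is_derive f x l'.
Proof. now intros H <-. Qed.

Lemma derive_const (c x : R) : is_derive (fun _ : R => c) x 0.
Proof. exact (is_derive_const (V := R_NormedModule) c x). Qed.

Lemma derive_id (x : R) : is_derive (fun t : R => t) x 1.
Proof. exact (is_derive_id x). Qed.

Lemma derive_plus (f h : R -> R) (x l m : R) :
  is_derive f x l -> is_derive h x m -> is_derive (fun t => f t + h t) x (l + m).
Proof. intros H1 H2; exact (is_derive_plus f h x l m H1 H2). Qed.

Lemma derive_minus (f h : R -> R) (x l m : R) :
  is_derive f x l -> is_derive h x m -> is_derive (fun t => f t - h t) x (l - m).
Proof. intros H1 H2; exact (is_derive_minus f h x l m H1 H2). Qed.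

Lemma derive_mult (f h : R -> R) (x l m : R) :
  is_derive f x l -> is_derive h x m ->
  is_derive (fun t => f t * h t) x (l * h x + f x * m).
Proof. intros H1 H2; exact (is_derive_mult f h x l m H1 H2 Rmult_comm). Qed.

(* Both tactics dispatch on the syntax of the goal: unification with a wrong
   rule would unfold the filters. *)
Ltac derive := cbv beta; lazymatch goal with
  | |- is_derive (fun _ => ?c) _ _ => apply derive_const
  | |- is_derive (fun t => t) _ _ => apply derive_id
  | |- is_derive (fun t => @?f t + @?h t) _ _ => apply (derive_plus f h); derive
  | |- is_derive (fun t => @?f t - @?h t) _ _ => apply (derive_minus f h); derive
  | |- is_derive (fun t => @?f t * @?h t) _ _ => apply (derive_mult f h); derive
  | |- is_derive (fun t => ?f t) ?x ?l => change (is_derive f x l);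
      match goal with H : forall t, is_derive f t _ |- _ => apply H end
  | H : forall t, is_derive ?f t _ |- is_derive ?f _ _ => apply H
  end.

Ltac cont := cbv beta; lazymatch goal with
  | |- cont (fun _ => ?c) => apply cont_const
  | |- cont (fun x => x) => apply cont_id
  | |- cont (fun x => @?f x + @?h x) => apply (cont_plus f h); cont
  | |- cont (fun x => @?f x - @?h x) => apply (cont_minus f h); cont
  | |- cont (fun x => - @?f x) => apply (cont_opp f); cont
  | |- cont (fun x => @?f x * @?h x) => apply (cont_mult f h); cont
  | |- cont (fun x => @?f x ^ ?n) => apply (cont_pow f n); cont
  | |- cont (fun x => ?f x) => change (cont f); try assumption
  | |- _ => try assumption
  end.

Lemma cont_ex_RInt (f : R -> R) (a b : R) : cont f -> ex_RInt f a b.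
Proof. intros Hf; apply (ex_RInt_continuous f); auto. Qed.

Lemma cont_RInt_le (f h : R -> R) (a b : R) : a <= b -> cont f -> cont h ->
  (forall x, a < x < b -> f x <= h x) -> RInt f a b <= RInt h a b.
Proof. intros; apply RInt_le; auto using cont_ex_RInt. Qed.

Lemma cont_RInt_plus (f h : R -> R) (a b : R) : cont f -> cont h ->
  RInt (fun x => f x + h x) a b = RInt f a b + RInt h a b.
Proof. intros; apply (RInt_plus f h a b); auto using cont_ex_RInt. Qed.

Lemma cont_RInt_minus (f h : R -> R) (a b : R) : cont f -> cont h ->
  RInt (fun x => f x - h x) a b = RInt f a b - RInt h a b.
Proof. intros; apply (RInt_minus f h a b); auto using cont_ex_RInt. Qed.

Lemma cont_RInt_scal (c : R) (f : R -> R) (a b : R) : cont f ->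
  RInt (fun x => c * f x) a b = c * RInt f a b.
Proof. intros; apply (RInt_scal f a b c); auto using cont_ex_RInt. Qed.

Lemma cont_RInt_ge_0 (f : R -> R) (a b : R) : a <= b -> cont f ->
  (forall x, a < x < b -> 0 <= f x) -> 0 <= RInt f a b.
Proof. intros; apply RInt_ge_0; auto using cont_ex_RInt. Qed.

Lemma RInt_ext_01 (f h : R -> R) : (forall x, 0 < x < 1 -> f x = h x) ->
  RInt f 0 1 = RInt h 0 1.
Proof. intros H; apply RInt_ext; rewrite Rmin_left, Rmax_right by lra; exact H. Qed.

Lemma RInt_lincomb3 (a b c : R) (f h l : R -> R) : cont f -> cont h -> cont l ->
  RInt (fun x => a * f x + b * h x + c * l x) 0 1
  = a * RInt f 0 1 + b * RInt h 0 1 + c * RInt l 0 1.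
Proof.
intros Hf Hh Hl.
rewrite (cont_RInt_plus (fun x => a * f x + b * h x) (fun x => c * l x)),
  (cont_RInt_plus (fun x => a * f x) (fun x => b * h x)), !cont_RInt_scal;
  cont; reflexivity.
Qed.

Lemma RInt_gt_0_at (f : R -> R) (a b x0 : R) : cont f ->
  (forall x, a < x < b -> 0 <= f x) -> a < x0 < b -> 0 < f x0 -> 0 < RInt f a b.
Proof.
intros Hf Hpos Hx0 Hfx0.
assert (Hloc : locally x0 (fun x => 0 < f x)).
{ apply (Hf x0 (fun z => 0 < z)). now apply open_gt. }
destruct Hloc as [d Hd].
assert (Hd0 := cond_pos d).
(* The interval of radius [e] around [x0] stays inside (a,b) and inside the neighbourhood where [f]
   is positive. *)
set (e := Rmin (d / 2) (Rmin ((x0 - a) / 2) ((b - x0) / 2))).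
assert (He : 0 < e /\ e < d /\ e < x0 - a /\ e < b - x0).
{ unfold e; repeat split; unfold Rmin; repeat destruct Rle_dec; lra. }
rewrite <- (RInt_Chasles f a (x0 - e) b) by now apply cont_ex_RInt.
rewrite <- (RInt_Chasles f (x0 - e) (x0 + e) b) by now apply cont_ex_RInt.
unfold plus; simpl.
assert (0 <= RInt f a (x0 - e)) by
  (apply cont_RInt_ge_0; [lra | assumption | intros; apply Hpos; lra]).
assert (0 <= RInt f (x0 + e) b) by
  (apply cont_RInt_ge_0; [lra | assumption | intros; apply Hpos; lra]).
assert (0 < RInt f (x0 - e) (x0 + e)).
{ apply RInt_gt_0; [lra | | intros; apply Hf].
  intros x Hx; apply Hd. change (Rabs (x - x0) < d).
  apply Rabs_def1; lra. }
lra.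
Qed.

Lemma cont_bounded (f : R -> R) : cont f ->
  exists M, 0 < M /\ forall y, 0 <= y <= 1 -> Rabs (f y) <= M.
Proof.
intros Hf.
assert (Hc : forall y, continuity_pt (fun x => Rabs (f x)) y).
{ intros y; apply continuity_pt_filterlim, (cont_comp f Rabs Hf cont_abs y). }
destruct (continuity_ab_maj (fun x => Rabs (f x)) 0 1) as [m [Hm _]]; [lra | auto |].
exists (Rabs (f m) + 1); split; [pose proof (Rabs_pos (f m)); lra |].
intros y Hy; specialize (Hm y Hy); lra.
Qed.

(** The integration constant is the value at 0, so nested antiderivatives carry initial data. *)
Definition antideriv (c : R) (f : R -> R) (y : R) : R := c + RInt f 0 y.

Lemma antideriv_derive (c : R) (f : R -> R) : cont f ->
  forall y, is_derive (antideriv c f) y (f y).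
Proof.
intros Hf y; unfold antideriv.
apply (is_derive_eq _ _ (0 + f y)); [| ring].
apply (derive_plus (fun _ => c) (fun y => RInt f 0 y)); [apply derive_const |].
apply (is_derive_RInt f (fun y => RInt f 0 y) 0 y); [| apply Hf].
apply filter_forall; intros z; apply (RInt_correct f), cont_ex_RInt, Hf.
Qed.

Lemma antideriv_0 (c : R) (f : R -> R) : antideriv c f 0 = c.
Proof. unfold antideriv; rewrite RInt_point; unfold zero; simpl; ring. Qed.

Lemma cont_antideriv (c : R) (f : R -> R) : cont f -> cont (antideriv c f).
Proof. intros Hf; apply (cont_derive _ f), antideriv_derive, Hf. Qed.

Lemma FTC (f f' : R -> R) (a b : R) : (forall x, is_derive f x (f' x)) -> cont f' ->
  RInt f' a b = f b - f a.
Proof.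
intros Hd Hc; apply is_RInt_unique.
apply (is_RInt_derive f f'); auto.
Qed.

Lemma exp_weight_derive (B x : R) : is_derive (fun t => exp (B * t)) x (B * exp (B * x)).
Proof. auto_derive; [trivial | ring]. Qed.

Lemma cont_exp_weight (B : R) : cont (fun t => exp (B * t)).
Proof. apply (cont_derive _ _ (exp_weight_derive B)). Qed.

(** In the sup norm weighted by exp(-B t), integration from 0 gains a factor 1/B, since the integral
    of exp(B t) over [0,y] is at most exp(B y)/B. A large [B] thus gives a contraction on all of
    [0,1] at once. *)
Lemma antideriv_contract (c b B : R) (f h : R -> R) : cont f -> cont h ->
  0 <= b -> 1 <= B ->
  (forall t, 0 <= t <= 1 -> Rabs (f t - h t) <= b * exp (B * t)) ->
  forall y, 0 <= y <= 1 ->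
  Rabs (antideriv c f y - antideriv c h y) <= b / B * exp (B * y).
Proof.
intros Hf Hh Hb HB Hfh y Hy; unfold antideriv.
assert (E : c + RInt f 0 y - (c + RInt h 0 y) = RInt (fun t => f t - h t) 0 y)
  by (rewrite cont_RInt_minus by assumption; ring).
rewrite E; clear E.
assert (Hd : cont (fun t => f t - h t)) by cont.
apply Rle_trans with (RInt (fun t => Rabs (f t - h t)) 0 y).
{ apply abs_RInt_le; [lra | now apply cont_ex_RInt]. }
apply Rle_trans with (RInt (fun t => b / B * (B * exp (B * t))) 0 y).
{ apply cont_RInt_le; [lra | now apply (cont_comp _ Rabs Hd cont_abs) | |].
  - repeat apply cont_mult; try apply cont_const; apply cont_exp_weight.
  - intros t Ht. replace (b / B * (B * exp (B * t))) with (b * exp (B * t)) by (field; lra).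
    apply Hfh; lra. }
rewrite (cont_RInt_scal (b / B) (fun t => B * exp (B * t))) by
  (apply cont_mult; [apply cont_const | apply cont_exp_weight]).
rewrite (FTC (fun t => exp (B * t)) (fun t => B * exp (B * t))).
- rewrite Rmult_0_r, exp_0. apply Rmult_le_compat_l; [| lra].
  apply Rmult_le_pos; [lra | left; apply Rinv_0_lt_compat; lra].
- apply exp_weight_derive.
- apply cont_mult; [apply cont_const | apply cont_exp_weight].
Qed.

(** The projection onto [0,1], written with absolute values so that its continuity is immediate. *)
Definition clamp (y : R) : R := (Rabs y - Rabs (y - 1) + 1) / 2.

Lemma clamp_range (y : R) : 0 <= clamp y <= 1.
Proof. unfold clamp; split_Rabs; lra. Qed.

Lemma clamp_id (y : R) : 0 <= y <= 1 -> clamp y = y.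
Proof. unfold clamp; intros; split_Rabs; lra. Qed.

Lemma cont_clamp : cont clamp.
Proof.
unfold clamp, Rdiv; apply cont_mult; [| apply cont_const].
apply cont_plus; [apply cont_minus | apply cont_const].
- apply cont_abs.
- apply (cont_comp (fun y => y - 1) Rabs); [cont | apply cont_abs].
Qed.

Lemma uniform_limit_cont (s : nat -> R -> R) (l : R -> R) :
  (forall n, cont (s n)) ->
  (forall e, 0 < e -> exists n, forall y, Rabs (s n y - l y) <= e) -> cont l.
Proof.
intros Hs Hl x; apply filterlim_locally; intros eps.
assert (He := cond_pos eps).
destruct (Hl (eps / 3)) as [n Hn]; [lra |].
assert (Hx := Hs n x).
apply filterlim_locally with (eps := mkposreal (eps / 3) ltac:(lra)) in Hx.
revert Hx; apply filter_imp; intros y Hy.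
change (Rabs (l y - l x) < eps). change (Rabs (s n y - s n x) < eps / 3) in Hy.
assert (Hnx := Hn x); assert (Hny := Hn y).
replace (l y - l x) with (- (s n y - l y) + (s n y - s n x) + (s n x - l x)) by ring.
eapply Rle_lt_trans; [apply Rabs_triang |].
assert (Ht := Rabs_triang (- (s n y - l y)) (s n y - s n x)).
rewrite Rabs_Ropp in Ht. lra.
Qed.

(* Freezing the right-hand side outside [0,1] keeps the iterates defined on R,
   so that one-sided derivatives never occur. *)
Lemma picard_fixed_point (G : (R -> R) -> R -> R) (B : R) : 0 <= B ->
  (forall h, cont h -> cont (G h)) ->
  (forall f h b, cont f -> cont h -> 0 <= b ->
     (forall t, 0 <= t <= 1 -> Rabs (f t - h t) <= b * exp (B * t)) ->
     forall t, 0 <= t <= 1 -> Rabs (G f t - G h t) <= b / 2 * exp (B * t)) ->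
  exists s, cont s /\ forall t, 0 <= t <= 1 -> s t = G s t.
Proof.
intros HB HGc HG.
set (s := fix s (n : nat) : R -> R :=
  match n with O => fun _ => 0 | S n => fun y => G (s n) (clamp y) end).
assert (Hsc : forall n, cont (s n)).
{ induction n as [|n IH]; simpl; [apply cont_const |].
  apply (cont_comp clamp); [apply cont_clamp | now apply HGc]. }
assert (Hcl : forall n y, s n y = s n (clamp y)).
{ destruct n; intros y; simpl; [reflexivity |].
  now rewrite (clamp_id (clamp y)) by apply clamp_range. }
(* As [s 0] is zero, [M] bounds the first increment of the iteration. *)
destruct (cont_bounded (s 1%nat) (Hsc 1%nat)) as [M [HM HMb]].
assert (Hw : forall t, 0 <= t <= 1 -> 1 <= exp (B * t) <= exp B).
{ intros t Ht; split.
  - rewrite <- exp_0; destruct (Req_dec (B * t) 0) as [->|]; [lra |].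
    left; apply exp_increasing. assert (0 <= B * t) by (apply Rmult_le_pos; lra). lra.
  - assert (B * t <= B) by (rewrite <- (Rmult_1_r B) at 2; apply Rmult_le_compat_l; lra).
    destruct (Req_dec (B * t) B) as [->|]; [lra |]. left; apply exp_increasing; lra. }
assert (Hstep : forall n t, 0 <= t <= 1 ->
  Rabs (s (S n) t - s n t) <= M * (/ 2) ^ n * exp (B * t)).
{ induction n as [|n IH]; intros t Ht.
  - replace (s 1%nat t - s 0%nat t) with (s 1%nat t) by (simpl; ring).
    specialize (HMb t Ht). specialize (Hw t Ht).
    rewrite pow_O, Rmult_1_r. apply Rle_trans with (M * 1); [lra |].
    apply Rmult_le_compat_l; lra.
  - change (s (S (S n)) t) with (G (s (S n)) (clamp t)).
    replace (s (S n) t) with (G (s n) (clamp t)) by reflexivity.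
    rewrite clamp_id by assumption.
    replace (M * (/ 2) ^ S n) with (M * (/ 2) ^ n / 2) by (simpl; field).
    apply HG; auto.
    apply Rmult_le_pos; [lra | apply pow_le; lra]. }
(* The factor 1 - (1/2)^m is the exact partial geometric sum; a bound without it would not pass
   through the induction on [m]. *)
assert (Htail : forall n m t, 0 <= t <= 1 ->
  Rabs (s (n + m)%nat t - s n t) <= 2 * M * (/ 2) ^ n * exp B * (1 - (/ 2) ^ m)).
{ intros n m t Ht; induction m as [|m IH].
  - rewrite Nat.add_0_r, Rminus_diag, Rabs_R0. simpl; lra.
  - rewrite Nat.add_succ_r.
    replace (s (S (n + m)) t - s n t)
      with ((s (S (n + m)) t - s (n + m)%nat t) + (s (n + m)%nat t - s n t)) by ring.
    eapply Rle_trans; [apply Rabs_triang |].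
    assert (H1 := Hstep (n + m)%nat t Ht). rewrite pow_add in H1.
    assert (H2 : M * ((/ 2) ^ n * (/ 2) ^ m) * exp (B * t)
                 <= M * ((/ 2) ^ n * (/ 2) ^ m) * exp B).
    { apply Rmult_le_compat_l; [| apply Hw, Ht].
      repeat apply Rmult_le_pos; try apply pow_le; lra. }
    replace (2 * M * (/ 2) ^ n * exp B * (1 - (/ 2) ^ S m)) with
      (M * ((/ 2) ^ n * (/ 2) ^ m) * exp B + 2 * M * (/ 2) ^ n * exp B * (1 - (/ 2) ^ m))
      by (simpl; field).
    lra. }
assert (HMB : 0 < 2 * M * exp B) by (assert (H := exp_pos B); apply Rmult_lt_0_compat; lra).
(* The iterates factor through [clamp], so the estimate on [0,1] holds on all of R and the
   convergence is uniform there. *)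
assert (Htail' : forall n m t, (n <= m)%nat ->
  Rabs (s m t - s n t) <= 2 * M * exp B * (/ 2) ^ n).
{ intros n m t Hnm. rewrite (Hcl m t), (Hcl n t).
  replace m with (n + (m - n))%nat by lia.
  eapply Rle_trans; [apply Htail, clamp_range |].
  replace (2 * M * (/ 2) ^ n * exp B * (1 - (/ 2) ^ (m - n))) with
    (2 * M * exp B * (/ 2) ^ n * (1 - (/ 2) ^ (m - n))) by ring.
  rewrite <- (Rmult_1_r (2 * M * exp B * (/ 2) ^ n)) at 2.
  apply Rmult_le_compat_l.
  - apply Rmult_le_pos; [lra | apply pow_le; lra].
  - assert (0 <= (/ 2) ^ (m - n)) by (apply pow_le; lra). lra. }
assert (Hsmall : forall e, 0 < e -> exists n, 2 * M * exp B * (/ 2) ^ n < e).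
{ intros e He.
  destruct (pow_lt_1_zero (/ 2)) with (y := e / (2 * M * exp B)) as [n Hn].
  - rewrite Rabs_pos_eq; lra.
  - now apply Rdiv_lt_0_compat.
  - exists n. specialize (Hn n (Nat.le_refl n)).
    rewrite Rabs_pos_eq in Hn by (apply pow_le; lra).
    apply (Rmult_lt_compat_l (2 * M * exp B)) in Hn; [| assumption].
    eapply Rlt_le_trans; [exact Hn |]. right; field; split; [| lra].
    assert (H := exp_pos B); lra. }
set (l := fun y => real (Lim_seq (fun n => s n y))).
assert (Hl : forall n y, Rabs (s n y - l y) <= 2 * M * exp B * (/ 2) ^ n).
{ intros n y.
  assert (Hcv : ex_finite_lim_seq (fun n => s n y)).
  { apply ex_lim_seq_cauchy_corr. intros e.
    destruct (Hsmall (e / 2)) as [N HN]; [assert (H := cond_pos e); lra |].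
    exists N; intros p q Hp Hq.
    replace (s p y - s q y) with ((s p y - s N y) - (s q y - s N y)) by ring.
    eapply Rle_lt_trans; [apply Rabs_triang |]. rewrite Rabs_Ropp.
    assert (H1 := Htail' N p y Hp). assert (H2 := Htail' N q y Hq). lra. }
  apply Lim_seq_correct' in Hcv. fold (l y) in Hcv.
  assert (Hc2 : is_lim_seq (fun m => Rabs (s n y - s m y)) (Rabs (s n y - l y))).
  { apply (is_lim_seq_abs (fun m => s n y - s m y) (s n y - l y)).
    apply is_lim_seq_minus'; [apply is_lim_seq_const | exact Hcv]. }
  apply (is_lim_seq_le_loc (fun m => Rabs (s n y - s m y))
    (fun _ => 2 * M * exp B * (/ 2) ^ n) (Rabs (s n y - l y))
    (2 * M * exp B * (/ 2) ^ n)); [| exact Hc2 | apply is_lim_seq_const].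
  exists n; intros m Hm. rewrite Rabs_minus_sym. now apply Htail'. }
assert (Hlc : cont l).
{ apply (uniform_limit_cont s); [assumption |]. intros e He.
  destruct (Hsmall e He) as [n Hn]. exists n; intros y. specialize (Hl n y); lra. }
exists l; split; [assumption |]. intros t Ht.
apply cond_eq; intros e He.
assert (HeB := exp_pos B).
(* The distance from [l t] to [G l t] is at most [d] for the limit plus [d * exp B] for the weighted
   contraction. *)
destruct (Hsmall (e / (1 + exp B))) as [n Hn]; [apply Rdiv_lt_0_compat; lra |].
set (d := 2 * M * exp B * (/ 2) ^ n) in *.
assert (Hd : 0 <= d) by (apply Rmult_le_pos; [lra | apply pow_le; lra]).
assert (H1 : Rabs (s (S n) t - l t) <= d).
{ eapply Rle_trans; [apply Hl |]. unfold d.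
  apply Rmult_le_compat_l; [lra |]. simpl.
  assert (0 <= (/ 2) ^ n) by (apply pow_le; lra). lra. }
assert (H2 : Rabs (G (s n) t - G l t) <= d / 2 * exp (B * t)).
{ apply HG; auto. intros u Hu. eapply Rle_trans; [apply Hl |]. fold d.
  rewrite <- (Rmult_1_r d) at 1. apply Rmult_le_compat_l; [assumption | apply Hw, Hu]. }
assert (H3 : d / 2 * exp (B * t) <= d * exp B).
{ apply Rmult_le_compat; try lra; [left; apply exp_pos | apply Hw, Ht]. }
replace (s (S n) t) with (G (s n) t) in H1 by (simpl; now rewrite clamp_id).
replace (l t - G l t) with (- (G (s n) t - l t) + (G (s n) t - G l t)) by ring.
eapply Rle_lt_trans; [apply Rabs_triang |]. rewrite Rabs_Ropp.
assert (H4 : d * (1 + exp B) < e).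
{ apply (Rmult_lt_compat_r (1 + exp B)) in Hn; [| lra].
  replace (e / (1 + exp B) * (1 + exp B)) with e in Hn by (field; lra). exact Hn. }
lra.
Qed.

(** * Fourth-order linear equations *)

(** A C^n function on R carried with its derivatives, [p i] being the i-th. Identities between
    derivatives are then polynomial in the values [p i y] and fall to [ring]; entries beyond [n] are
    arbitrary. *)
Definition chain (n : nat) (p : nat -> R -> R) : Prop :=
  (forall i, (i < n)%nat -> forall x, is_derive (p i) x (p (S i) x)) /\ cont (p n).

Lemma chain_cont (n i : nat) (p : nat -> R -> R) : chain n p -> (i <= n)%nat -> cont (p i).
Proof.
intros [Hd Hc] Hi. destruct (Nat.eq_dec i n) as [-> | Hn]; [assumption |].
apply (cont_derive _ (p (S i))), Hd; lia.
Qed.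

Lemma chain_le (m n : nat) (p : nat -> R -> R) : chain n p -> (m <= n)%nat -> chain m p.
Proof.
intros H Hm; split; [| now apply (chain_cont n)].
intros i Hi; apply (proj1 H); lia.
Qed.

Lemma chain_lincomb (n : nat) (a b : R) (p q : nat -> R -> R) :
  chain n p -> chain n q -> chain n (fun i x => a * p i x + b * q i x).
Proof.
intros [Hp Hpc] [Hq Hqc]; split; [| cont].
intros i Hi x. cbv beta. eapply is_derive_eq.
- assert (Dp := Hp i Hi). assert (Dq := Hq i Hi). derive.
- ring.
Qed.

(** The mode equation contains no third derivative, hence three coefficients. The equation is
    confined to [0,1], where the Picard fixed point satisfies it. *)
Definition solves4 (a0 a1 a2 f : R -> R) (u : nat -> R -> R) : Prop :=
  chain 4 u /\ forall y, 0 <= y <= 1 ->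
    u 4%nat y = a0 y * u 0%nat y + a1 y * u 1%nat y + a2 y * u 2%nat y + f y.

(** The unknown of the Picard iteration is the fourth derivative; the lower ones are its iterated
    antiderivatives, with the initial data as integration constants. *)
Lemma ode4_exists (a0 a1 a2 f : R -> R) (c0 c1 c2 c3 : R) :
  cont a0 -> cont a1 -> cont a2 -> cont f ->
  exists u, solves4 a0 a1 a2 f u /\
    u 0%nat 0 = c0 /\ u 1%nat 0 = c1 /\ u 2%nat 0 = c2 /\ u 3%nat 0 = c3.
Proof.
intros H0 H1 H2 Hf.
destruct (cont_bounded a0 H0) as [M0 [HM0 B0]].
destruct (cont_bounded a1 H1) as [M1 [HM1 B1]].
destruct (cont_bounded a2 H2) as [M2 [HM2 B2]].
set (P3 := antideriv c3).
set (P2 := fun s => antideriv c2 (P3 s)).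
set (P1 := fun s => antideriv c1 (P2 s)).
set (P0 := fun s => antideriv c0 (P1 s)).
assert (C3 : forall s, cont s -> cont (P3 s)) by (intros; now apply cont_antideriv).
assert (C2 : forall s, cont s -> cont (P2 s)) by (intros; apply cont_antideriv; auto).
assert (C1 : forall s, cont s -> cont (P1 s)) by (intros; apply cont_antideriv; auto).
assert (C0 : forall s, cont s -> cont (P0 s)) by (intros; apply cont_antideriv; auto).
(* One integration gains 1/B and further ones lose nothing as B >= 1, so the contraction factor is
   at most (M0 + M1 + M2)/B <= 1/2. *)
set (B := 1 + 2 * (M0 + M1 + M2)).
assert (HB : 1 <= B) by (unfold B; lra).
destruct (picard_fixed_point
  (fun s y => a0 y * P0 s y + a1 y * P1 s y + a2 y * P2 s y + f y) B) as [s [Hs Es]].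
- lra.
- intros h Hh; specialize (C2 h Hh); specialize (C1 h Hh); specialize (C0 h Hh); cont.
- intros h h' b Hh Hh' Hb Hd t Ht.
  set (w := fun t => exp (B * t)) in *.
  assert (Hdiv : forall x, 0 <= x -> 0 <= x / B <= x).
  { intros x Hx; split.
    - apply Rmult_le_pos; [lra | left; apply Rinv_0_lt_compat; lra].
    - apply Rmult_le_reg_r with B; [lra |]. unfold Rdiv.
      rewrite Rmult_assoc, Rinv_l, Rmult_1_r by lra.
      rewrite <- (Rmult_1_r x) at 1. apply Rmult_le_compat_l; lra. }
  assert (Hstep : forall c b f1 f2, cont f1 -> cont f2 -> 0 <= b ->
    (forall t, 0 <= t <= 1 -> Rabs (f1 t - f2 t) <= b * exp (B * t)) ->
    forall t, 0 <= t <= 1 ->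
    Rabs (antideriv c f1 t - antideriv c f2 t) <= b * exp (B * t)).
  { intros c b' f1 f2 K1 K2 K3 K4 u Hu.
    eapply Rle_trans; [apply (antideriv_contract c b' B f1 f2); auto |].
    apply Rmult_le_compat_r; [left; apply exp_pos | apply Hdiv, K3]. }
  assert (Hb' := Hdiv b Hb).
  assert (D3 : forall t, 0 <= t <= 1 -> Rabs (P3 h t - P3 h' t) <= b / B * exp (B * t)).
  { intros; now apply antideriv_contract. }
  assert (D2 : forall t, 0 <= t <= 1 -> Rabs (P2 h t - P2 h' t) <= b / B * exp (B * t)).
  { intros; apply Hstep; auto; lra. }
  assert (D1 : forall t, 0 <= t <= 1 -> Rabs (P1 h t - P1 h' t) <= b / B * exp (B * t)).
  { intros; apply Hstep; auto; lra. }
  assert (D0 : forall t, 0 <= t <= 1 -> Rabs (P0 h t - P0 h' t) <= b / B * exp (B * t)).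
  { intros; apply Hstep; auto; lra. }
  replace (a0 t * P0 h t + a1 t * P1 h t + a2 t * P2 h t + f t -
    (a0 t * P0 h' t + a1 t * P1 h' t + a2 t * P2 h' t + f t)) with
    (a0 t * (P0 h t - P0 h' t) + a1 t * (P1 h t - P1 h' t) + a2 t * (P2 h t - P2 h' t)) by ring.
  set (e := b / B * exp (B * t)) in *.
  assert (He : 0 <= e) by (apply Rmult_le_pos; [lra | left; apply exp_pos]).
  assert (T0 : Rabs (a0 t * (P0 h t - P0 h' t)) <= M0 * e).
  { rewrite Rabs_mult; apply Rmult_le_compat; [apply Rabs_pos | apply Rabs_pos | now apply B0 | now apply D0]. }
  assert (T1 : Rabs (a1 t * (P1 h t - P1 h' t)) <= M1 * e).
  { rewrite Rabs_mult; apply Rmult_le_compat; [apply Rabs_pos | apply Rabs_pos | now apply B1 | now apply D1]. }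
  assert (T2 : Rabs (a2 t * (P2 h t - P2 h' t)) <= M2 * e).
  { rewrite Rabs_mult; apply Rmult_le_compat; [apply Rabs_pos | apply Rabs_pos | now apply B2 | now apply D2]. }
  assert (T := Rabs_triang (a0 t * (P0 h t - P0 h' t) + a1 t * (P1 h t - P1 h' t))
    (a2 t * (P2 h t - P2 h' t))).
  assert (T' := Rabs_triang (a0 t * (P0 h t - P0 h' t)) (a1 t * (P1 h t - P1 h' t))).
  replace (b / 2 * exp (B * t)) with (B * e / 2) by (unfold e; field; lra).
  unfold B; lra.
- exists (fun i => match i with
    0%nat => P0 s | 1%nat => P1 s | 2%nat => P2 s | 3%nat => P3 s | _ => s end).
  split; [split; [split; [| assumption] | assumption] | repeat split; apply antideriv_0].
  intros i Hi x.
  destruct i as [|[|[|[|i]]]]; [| | | | lia]; apply antideriv_derive; auto.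
Qed.

Lemma nonincreasing_of_derive (h h' : R -> R) (y : R) :
  (forall t, is_derive h t (h' t)) -> (forall t, 0 <= t <= y -> h' t <= 0) -> 0 <= y ->
  h y <= h 0.
Proof.
intros Hd Hn Hy.
destruct (MVT_gen h 0 y h') as [c [Hc E]].
- intros; apply Hd.
- intros x _; apply continuity_pt_filterlim, (cont_derive h h' Hd x).
- rewrite Rmin_left, Rmax_right in Hc by lra.
  assert (H := Hn c Hc). nra.
Qed.

(** Gronwall's inequality for the sum of squares of u, u', u'', u'''. The constant depends on the
    coefficients alone, which makes the inverse built by shooting bounded. *)
Lemma ode4_energy (a0 a1 a2 : R -> R) : cont a0 -> cont a1 -> cont a2 ->
  exists N, 0 < N /\ forall f u, cont f -> solves4 a0 a1 a2 f u ->
    (forall i, (i < 4)%nat -> u i 0 = 0) ->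
    forall i y, (i < 4)%nat -> 0 <= y <= 1 -> u i y ^ 2 <= N * RInt (fun t => f t ^ 2) 0 1.
Proof.
intros H0 H1 H2.
destruct (cont_bounded a0 H0) as [M0 [HM0 B0]].
destruct (cont_bounded a1 H1) as [M1 [HM1 B1]].
destruct (cont_bounded a2 H2) as [M2 [HM2 B2]].
(* Young's inequality on every product in [E']: neighbouring derivatives and the forcing cost at
   most 2 per square, the coefficient terms at most M0 + M1 + M2. *)
set (C := 3 + M0 + M1 + M2).
exists (exp C); split; [apply exp_pos |].
intros f u Hf [Hu Eu] Hini i y Hi Hy.
assert (D := proj1 Hu).
assert (D0 := D 0%nat ltac:(lia)). assert (D1 := D 1%nat ltac:(lia)).
assert (D2 := D 2%nat ltac:(lia)). assert (D3 := D 3%nat ltac:(lia)). clear D.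
set (E := fun t => u 0%nat t * u 0%nat t + u 1%nat t * u 1%nat t
                   + u 2%nat t * u 2%nat t + u 3%nat t * u 3%nat t).
set (E' := fun t => 2 * (u 0%nat t * u 1%nat t + u 1%nat t * u 2%nat t
                   + u 2%nat t * u 3%nat t + u 3%nat t * u 4%nat t)).
assert (DE : forall t, is_derive E t (E' t)).
{ intros t; eapply is_derive_eq.
  - unfold E. derive.
  - unfold E'; ring. }
set (F := antideriv 0 (fun t => f t ^ 2)).
assert (Hf2 : cont (fun t => f t ^ 2)) by cont.
assert (HEbound : forall t, 0 <= t <= 1 -> E' t <= C * E t + f t ^ 2).
{ intros t Ht. unfold E', E. rewrite (Eu t Ht).
  specialize (B0 t Ht); specialize (B1 t Ht); specialize (B2 t Ht).
  assert (K : forall a M p q, Rabs a <= M -> 2 * (q * (a * p)) <= M * (p * p + q * q)).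
  { clear. intros a M p q Ha.
    assert (2 * (q * (a * p)) <= Rabs (2 * (q * (a * p)))) by apply Rle_abs.
    rewrite !Rabs_mult, (Rabs_pos_eq 2) in H by lra.
    assert (K1 : 2 * (Rabs q * Rabs p) <= p * p + q * q).
    { assert (0 <= (Rabs q - Rabs p) ^ 2) by apply pow2_ge_0.
      assert (Rabs q * Rabs q = q * q) by (rewrite <- Rabs_mult; apply Rabs_pos_eq; nra).
      assert (Rabs p * Rabs p = p * p) by (rewrite <- Rabs_mult; apply Rabs_pos_eq; nra).
      lra. }
    assert (Hp := Rabs_pos a).
    assert (Rabs a * (2 * (Rabs q * Rabs p)) <= M * (p * p + q * q)); [| lra].
    apply Rmult_le_compat; try assumption.
    assert (0 <= Rabs q * Rabs p) by (apply Rmult_le_pos; apply Rabs_pos). lra. }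
  assert (K0 := K _ _ (u 0%nat t) (u 3%nat t) B0).
  assert (K1 := K _ _ (u 1%nat t) (u 3%nat t) B1).
  assert (K2 := K _ _ (u 2%nat t) (u 3%nat t) B2).
  unfold C.
  revert K0 K1 K2.
  generalize (u 0%nat t) (u 1%nat t) (u 2%nat t) (u 3%nat t); intros w0 w1 w2 w3 K0 K1 K2.
  assert (0 <= (w0 - w1) ^ 2) by apply pow2_ge_0.
  assert (0 <= (w1 - w2) ^ 2) by apply pow2_ge_0.
  assert (0 <= (w2 - w3) ^ 2) by apply pow2_ge_0.
  assert (0 <= (w3 - f t) ^ 2) by apply pow2_ge_0.
  assert (0 <= M0 * (w1 ^ 2 + w2 ^ 2)) by (apply Rmult_le_pos; nra).
  assert (0 <= M1 * (w0 ^ 2 + w2 ^ 2)) by (apply Rmult_le_pos; nra).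
  assert (0 <= M2 * (w0 ^ 2 + w1 ^ 2)) by (apply Rmult_le_pos; nra).
  nra. }
(* Integrating factor: the derivative is exp(-C t) (E' - C E) - f^2, nonpositive because exp(-C t)
   <= 1. *)
assert (Hmono : exp (- C * y) * E y - F y <= exp (- C * 0) * E 0 - F 0).
{ apply (nonincreasing_of_derive (fun t => exp (- C * t) * E t - F t)
    (fun t => - C * exp (- C * t) * E t + exp (- C * t) * E' t - f t ^ 2)); [| | lra].
  - intros t; apply (derive_minus (fun t => exp (- C * t) * E t) F);
      [apply (derive_mult (fun t => exp (- C * t)) E) |].
    + apply (exp_weight_derive (- C)).
    + apply DE.
    + apply (antideriv_derive 0 (fun t => f t ^ 2) Hf2).
  - intros t Ht. assert (Hb := HEbound t ltac:(lra)).
    assert (He : 0 < exp (- C * t) <= 1).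
    { split; [apply exp_pos |]. rewrite <- exp_0.
      destruct (Req_dec t 0) as [-> |]; [right; f_equal; ring |].
      left; apply exp_increasing. assert (0 < C * t); [| lra].
      apply Rmult_lt_0_compat; [unfold C |]; lra. }
    assert (Hf2t : 0 <= f t ^ 2) by apply pow2_ge_0.
    assert (exp (- C * t) * (E' t - C * E t) <= 1 * f t ^ 2); [| lra].
    apply Rle_trans with (exp (- C * t) * f t ^ 2).
    + apply Rmult_le_compat_l; lra.
    + apply Rmult_le_compat_r; lra. }
replace (E 0) with 0 in Hmono
  by (unfold E; rewrite !Hini by lia; ring).
unfold F at 2 in Hmono; rewrite antideriv_0 in Hmono.
assert (HF : F y <= RInt (fun t => f t ^ 2) 0 1).
{ unfold F, antideriv. rewrite <- (RInt_Chasles _ 0 y 1) by now apply cont_ex_RInt.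
  unfold plus; simpl.
  assert (0 <= RInt (fun t => f t ^ 2) y 1); [| simpl in *; lra].
  apply cont_RInt_ge_0; [lra | assumption | intros; apply pow2_ge_0]. }
assert (HF0 : 0 <= RInt (fun t => f t ^ 2) 0 1).
{ apply cont_RInt_ge_0; [lra | assumption | intros; apply pow2_ge_0]. }
assert (HE : E y <= exp C * RInt (fun t => f t ^ 2) 0 1).
{ replace (E y) with (exp (C * y) * (exp (- C * y) * E y)).
  - apply Rmult_le_compat.
    + left; apply exp_pos.
    + apply Rmult_le_pos; [left; apply exp_pos | unfold E; nra].
    + assert (HC : C * y <= C) by (assert (0 < C) by (unfold C; lra); nra).
      destruct HC as [HC | ->]; [left; now apply exp_increasing | lra].
    + lra.
  - rewrite <- Rmult_assoc, <- exp_plus.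
    replace (C * y + - C * y) with 0 by ring. rewrite exp_0; ring. }
apply Rle_trans with (E y); [| assumption].
unfold E. destruct i as [|[|[|[|j]]]]; [| | | | lia]; nra.
Qed.

(** By incompressibility u_1 is proportional to phi', so the slip condition on u_1 ties phi'' to
    phi'. *)
Definition slip_bc (kap0 kap1 : R) (u : nat -> R -> R) : Prop :=
  u 0%nat 0 = 0 /\ u 0%nat 1 = 0 /\
  u 2%nat 0 = kap0 * u 1%nat 0 /\ u 2%nat 1 = kap1 * u 1%nat 1.

(* The shooting determinant at y = 1 of the two solutions satisfying the
   boundary conditions at y = 0 either vanishes or can be divided by. *)
Lemma fredholm_alternative (a0 a1 a2 : R -> R) (kap0 kap1 : R) :
  cont a0 -> cont a1 -> cont a2 ->
  (exists u, solves4 a0 a1 a2 (fun _ => 0) u /\ slip_bc kap0 kap1 u /\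
     (u 1%nat 0 <> 0 \/ u 3%nat 0 <> 0)) \/
  (exists M, 0 < M /\ forall f, cont f ->
     exists u, solves4 a0 a1 a2 f u /\ slip_bc kap0 kap1 u /\
       RInt (fun y => u 0%nat y ^ 2) 0 1 <= M * RInt (fun y => f y ^ 2) 0 1).
Proof.
intros H0 H1 H2.
(* The data of [p] and [q] span the initial values allowed by the conditions at 0, with u'(0) and
   u'''(0) as free parameters. *)
destruct (ode4_exists a0 a1 a2 (fun _ => 0) 0 1 kap0 0) as [p [[Cp Ep] [P0 [P1 [P2 P3]]]]];
  [auto using cont_const | auto using cont_const | auto using cont_const | apply cont_const |].
destruct (ode4_exists a0 a1 a2 (fun _ => 0) 0 0 0 1) as [q [[Cq Eq] [Q0 [Q1 [Q2 Q3]]]]];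
  [auto using cont_const | auto using cont_const | auto using cont_const | apply cont_const |].
set (bp := p 2%nat 1 - kap1 * p 1%nat 1).
set (bq := q 2%nat 1 - kap1 * q 1%nat 1).
set (D := p 0%nat 1 * bq - q 0%nat 1 * bp).
destruct (Req_dec D 0) as [HD | HD].
- left.
  (* A null vector of the singular two-by-two system at y = 1; the cases pick a row whose entry for
     [q] is nonzero. *)
  assert (Hsol : exists a b, (a <> 0 \/ b <> 0) /\
    a * p 0%nat 1 + b * q 0%nat 1 = 0 /\ a * bp + b * bq = 0).
  { destruct (Req_dec (q 0%nat 1) 0) as [Z1 | Z1]; [destruct (Req_dec bq 0) as [Z2 | Z2] |].
    - exists 0, 1. repeat split; [right; lra | rewrite Z1; ring | rewrite Z2; ring].
    - exists bq, (- bp). repeat split; [now left | unfold D in HD; lra | ring].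
    - exists (q 0%nat 1), (- p 0%nat 1).
      repeat split; [now left | ring | unfold D in HD; lra]. }
  destruct Hsol as [a [b [Hab [E1 E2]]]].
  exists (fun i x => a * p i x + b * q i x). split; [split |split].
  + now apply chain_lincomb.
  + intros y Hy. rewrite Ep, Eq by assumption. ring.
  + unfold slip_bc. rewrite P0, P1, P2, Q0, Q1, Q2. unfold bp, bq in E2.
    repeat split; lra.
  (* By the choice of initial data, [a] is u'(0) and [b] is u'''(0). *)
  + rewrite P1, P3, Q1, Q3. destruct Hab; [left | right]; lra.
- right.
  destruct (ode4_energy a0 a1 a2 H0 H1 H2) as [N [HN HE]].
  destruct (cont_bounded (p 0%nat) (chain_cont 4 0 p Cp ltac:(lia))) as [Mp [HMp Bp]].
  destruct (cont_bounded (q 0%nat) (chain_cont 4 0 q Cq ltac:(lia))) as [Mq [HMq Bq]].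
  set (Ka := 3 * (bq ^ 2 + q 0%nat 1 ^ 2 * (1 + kap1 ^ 2)) / D ^ 2).
  set (Kb := 3 * (bp ^ 2 + p 0%nat 1 ^ 2 * (1 + kap1 ^ 2)) / D ^ 2).
  assert (HD2 : 0 < D ^ 2) by (apply pow2_gt_0; assumption).
  assert (HKa : 0 <= Ka).
  { apply Rmult_le_pos; [nra | left; now apply Rinv_0_lt_compat]. }
  assert (HKb : 0 <= Kb).
  { apply Rmult_le_pos; [nra | left; now apply Rinv_0_lt_compat]. }
  exists (3 * N * (1 + Ka * Mp ^ 2 + Kb * Mq ^ 2)).
  assert (0 <= Ka * Mp ^ 2) by (apply Rmult_le_pos; nra).
  assert (0 <= Kb * Mq ^ 2) by (apply Rmult_le_pos; nra).
  split; [nra |].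
  intros f Hf.
  destruct (ode4_exists a0 a1 a2 f 0 0 0 0) as [w [[Cw Ew] [W0 [W1 [W2 W3]]]]];
    [assumption | assumption | assumption | assumption |].
  assert (HI : 0 <= RInt (fun t => f t ^ 2) 0 1).
  { apply cont_RInt_ge_0; [lra | cont | intros; apply pow2_ge_0]. }
  assert (HW : forall i y, (i < 4)%nat -> 0 <= y <= 1 ->
    w i y ^ 2 <= N * RInt (fun t => f t ^ 2) 0 1).
  { apply HE; [assumption | now split |].
    intros i Hi; destruct i as [|[|[|[|j]]]]; auto; lia. }
  set (bw := w 2%nat 1 - kap1 * w 1%nat 1).
  (* Cramer's rule for the combination of [p] and [q] that cancels the boundary defect of the
     particular solution [w] at y = 1. *)
  set (a := (q 0%nat 1 * bw - w 0%nat 1 * bq) / D).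
  set (b := (w 0%nat 1 * bp - p 0%nat 1 * bw) / D).
  set (I := RInt (fun t => f t ^ 2) 0 1) in *.
  assert (K0 := HW 0%nat 1 ltac:(lia) ltac:(lra)).
  assert (K1 := HW 1%nat 1 ltac:(lia) ltac:(lra)).
  assert (K2 := HW 2%nat 1 ltac:(lia) ltac:(lra)).
  assert (HN1 : 0 <= N * I) by (apply Rmult_le_pos; lra).
  (* One estimate serves both coefficients; the 3 comes from bounding the square of a sum of three
     terms by three times the sum of squares. *)
  assert (Hcoef : forall r s, ((r * bw - w 0%nat 1 * s) / D) ^ 2
            <= 3 * (s ^ 2 + r ^ 2 * (1 + kap1 ^ 2)) / D ^ 2 * (N * I)).
  { intros r s.
    replace (((r * bw - w 0%nat 1 * s) / D) ^ 2) with ((r * bw - w 0%nat 1 * s) ^ 2 / D ^ 2)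
      by (field; assumption).
    replace (3 * (s ^ 2 + r ^ 2 * (1 + kap1 ^ 2)) / D ^ 2 * (N * I)) with
      (3 * (s ^ 2 * (N * I) + r ^ 2 * (N * I) + (r * kap1) ^ 2 * (N * I)) / D ^ 2)
      by (field; assumption).
    apply Rmult_le_compat_r; [left; now apply Rinv_0_lt_compat |].
    assert (s ^ 2 * w 0%nat 1 ^ 2 <= s ^ 2 * (N * I)) by
      (apply Rmult_le_compat_l; [apply pow2_ge_0 | assumption]).
    assert (r ^ 2 * w 2%nat 1 ^ 2 <= r ^ 2 * (N * I)) by
      (apply Rmult_le_compat_l; [apply pow2_ge_0 | assumption]).
    assert ((r * kap1) ^ 2 * w 1%nat 1 ^ 2 <= (r * kap1) ^ 2 * (N * I)) by
      (apply Rmult_le_compat_l; [apply pow2_ge_0 | assumption]).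
    unfold bw.
    set (A1 := r * w 2%nat 1). set (A2 := r * kap1 * w 1%nat 1). set (A3 := s * w 0%nat 1).
    replace (r * (w 2%nat 1 - kap1 * w 1%nat 1) - w 0%nat 1 * s) with (A1 - A2 - A3)
      by (unfold A1, A2, A3; ring).
    apply Rle_trans with (3 * (A1 ^ 2 + A2 ^ 2 + A3 ^ 2)).
    - assert (0 <= (A1 + A2) ^ 2) by apply pow2_ge_0.
      assert (0 <= (A1 + A3) ^ 2) by apply pow2_ge_0.
      assert (0 <= (A2 - A3) ^ 2) by apply pow2_ge_0. nra.
    - unfold A1, A2, A3. rewrite !Rpow_mult_distr in *. lra. }
  assert (Ha : a ^ 2 <= Ka * (N * I)) by apply Hcoef.
  assert (Hb : b ^ 2 <= Kb * (N * I)).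
  { replace (b ^ 2) with (((p 0%nat 1 * bw - w 0%nat 1 * bp) / D) ^ 2)
      by (unfold b; field; assumption). apply Hcoef. }
  exists (fun i x => 1 * w i x + 1 * (a * p i x + b * q i x)).
  assert (Cu : chain 4 (fun i x => 1 * w i x + 1 * (a * p i x + b * q i x))).
  { apply chain_lincomb; [assumption |]. now apply chain_lincomb. }
  split; [split; [assumption |] | split].
  + intros y Hy. rewrite Ew, Ep, Eq by assumption. ring.
  + unfold slip_bc. rewrite P0, P1, P2, Q0, Q1, Q2, W0, W1, W2. repeat split; try ring.
    * unfold a, b. field_simplify; [| assumption].
      replace (_ + _) with (w 0%nat 1 * (D - (p 0%nat 1 * bq - q 0%nat 1 * bp))) by ring.
      unfold D at 1. field. assumption.
    * assert (X : bw + a * bp + b * bq = 0).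
      { unfold a, b. apply (Rmult_eq_reg_l D); [| assumption]. field_simplify; [| assumption].
        unfold D. ring. }
      unfold bw, bp, bq in X. lra.
  + apply Rle_trans with (RInt (fun _ => 3 * N * (1 + Ka * Mp ^ 2 + Kb * Mq ^ 2) * I) 0 1).
    * assert (Cp0 := chain_cont 4 0 _ Cp ltac:(lia)). assert (Cq0 := chain_cont 4 0 _ Cq ltac:(lia)).
      assert (Cw0 := chain_cont 4 0 _ Cw ltac:(lia)).
      apply cont_RInt_le; [lra | cont | cont |].
      intros y Hy. assert (Hy1 : 0 <= y <= 1) by lra.
      assert (Ky := HW 0%nat y ltac:(lia) Hy1).
      assert (Hp : (a * p 0%nat y) ^ 2 <= Ka * (N * I) * Mp ^ 2).
      { rewrite Rpow_mult_distr. apply Rmult_le_compat; try apply pow2_ge_0; auto.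
        apply pow_maj_Rabs, Bp, Hy1. }
      assert (Hq : (b * q 0%nat y) ^ 2 <= Kb * (N * I) * Mq ^ 2).
      { rewrite Rpow_mult_distr. apply Rmult_le_compat; try apply pow2_ge_0; auto.
        apply pow_maj_Rabs, Bq, Hy1. }
      set (A1 := w 0%nat y) in *. set (A2 := a * p 0%nat y) in *. set (A3 := b * q 0%nat y) in *.
      assert (0 <= (A1 - A2) ^ 2) by apply pow2_ge_0.
      assert (0 <= (A1 - A3) ^ 2) by apply pow2_ge_0.
      assert (0 <= (A2 - A3) ^ 2) by apply pow2_ge_0. nra.
    * rewrite RInt_const. unfold scal; simpl; unfold mult; simpl. lra.
Qed.

(** * The quadratic form of the normal mode problem *)

(** [wave] will be 1/L, and [dens] an extension of the density from (0,1) to a C^1 function on R. *)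
Record setting := {
  visc : R; wave : R; grav : R; slip0 : R; slip1 : R;
  dens : R -> R; ddens : R -> R;
  visc_pos : 0 < visc;
  wave_pos : 0 < wave;
  grav_pos : 0 < grav;
  dens_derive : forall y, is_derive dens y (ddens y);
  ddens_cont : cont ddens;
  dens_lower : exists r, 0 < r /\ forall y, 0 <= y <= 1 -> r <= dens y;
  ddens_pos_somewhere : exists y0, 0 < y0 < 1 /\ 0 < ddens y0
}.

Lemma dens_cont (P : setting) : cont (dens P).
Proof. exact (cont_derive _ _ (dens_derive P)). Qed.

Definition slip_weight (P : setting) (y : R) : R := slip1 P * y - slip0 P * (1 - y).

(** For p = q = phi and k = [wave P], this is k^2 rho |v|^2 for v = (- phi'/k sin kx, phi cos kx)
    without its trigonometric factors; likewise the viscous part of [dissipation] is k^2 mu |grad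
    v|^2. *)
Definition inertia (P : setting) (p q : nat -> R -> R) (y : R) : R :=
  dens P y * (wave P ^ 2 * (p 0%nat y * q 0%nat y) + p 1%nat y * q 1%nat y).

(* The boundary term [slip1 p' q'](1) + [slip0 p' q'](0) is the integral of
   [(slip_weight p' q')']. *)
Definition dissipation (P : setting) (p q : nat -> R -> R) (y : R) : R :=
  visc P * (p 2%nat y * q 2%nat y + 2 * wave P ^ 2 * (p 1%nat y * q 1%nat y)
            + wave P ^ 4 * (p 0%nat y * q 0%nat y))
  - ((slip0 P + slip1 P) * (p 1%nat y * q 1%nat y)
     + slip_weight P y * (p 1%nat y * q 2%nat y + p 2%nat y * q 1%nat y)).

Definition buoyancy (P : setting) (p q : nat -> R -> R) (y : R) : R :=
  grav P * wave P ^ 2 * ddens P y * (p 0%nat y * q 0%nat y).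

Definition form_density (P : setting) (lam : R) (p q : nat -> R -> R) (y : R) : R :=
  lam ^ 2 * inertia P p q y + lam * dissipation P p q y + (-1) * buoyancy P p q y.

Definition form (P : setting) (lam : R) (p q : nat -> R -> R) : R :=
  RInt (form_density P lam p q) 0 1.

(** Only impermeability is imposed: the slip condition is the natural boundary condition of the
    form. *)
Definition test_function (p : nat -> R -> R) : Prop :=
  chain 2 p /\ p 0%nat 0 = 0 /\ p 0%nat 1 = 0.

Definition mass (p : nat -> R -> R) : R := RInt (fun y => p 0%nat y ^ 2) 0 1.

Definition energy (p : nat -> R -> R) : R :=
  RInt (fun y => p 0%nat y ^ 2 + p 1%nat y ^ 2 + p 2%nat y ^ 2) 0 1.

Lemma cont_slip_weight (P : setting) : cont (slip_weight P).
Proof. unfold slip_weight; cont. Qed.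

Lemma cont_chain2 (p : nat -> R -> R) : chain 2 p ->
  cont (p 0%nat) /\ cont (p 1%nat) /\ cont (p 2%nat).
Proof. intros H; repeat split; apply (chain_cont 2); auto with arith. Qed.

Lemma cont_densities (P : setting) (p q : nat -> R -> R) : chain 2 p -> chain 2 q ->
  cont (inertia P p q) /\ cont (dissipation P p q) /\ cont (buoyancy P p q).
Proof.
intros Hp Hq.
destruct (cont_chain2 p Hp) as [P0 [P1 P2]]. destruct (cont_chain2 q Hq) as [Q0 [Q1 Q2]].
assert (Hr := dens_cont P). assert (Hd := ddens_cont P). assert (Hm := cont_slip_weight P).
unfold inertia, dissipation, buoyancy; split; [|split]; cont.
Qed.

Lemma cont_form_density (P : setting) (lam : R) (p q : nat -> R -> R) :
  chain 2 p -> chain 2 q -> cont (form_density P lam p q).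
Proof.
intros Hp Hq. destruct (cont_densities P p q Hp Hq) as [H1 [H2 H3]].
unfold form_density; cont.
Qed.

Lemma form_expand (P : setting) (lam : R) (p q : nat -> R -> R) : chain 2 p -> chain 2 q ->
  form P lam p q = lam ^ 2 * RInt (inertia P p q) 0 1 + lam * RInt (dissipation P p q) 0 1
    - RInt (buoyancy P p q) 0 1.
Proof.
intros Hp Hq. destruct (cont_densities P p q Hp Hq) as [H1 [H2 H3]].
unfold form, form_density. rewrite RInt_lincomb3 by assumption. ring.
Qed.

Lemma form_quadratic (P : setting) (lam t : R) (u p : nat -> R -> R) :
  chain 2 u -> chain 2 p ->
  let v := fun i x => 1 * u i x + t * p i x in
  form P lam v v = form P lam u u + 2 * t * form P lam u p + t ^ 2 * form P lam p p.
Proof.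
intros Hu Hp v.
assert (E : form P lam v v = RInt (fun y => 1 * form_density P lam u u y
  + 2 * t * form_density P lam u p y + t ^ 2 * form_density P lam p p y) 0 1).
{ unfold form; apply RInt_ext_01; intros y _.
  unfold v, form_density, inertia, dissipation, buoyancy; ring. }
rewrite E, RInt_lincomb3 by (now apply cont_form_density).
unfold form; ring.
Qed.

(** The second momentum equation times lam k^2, after the density is eliminated by the mass equation
    and the pressure by the first momentum equation. *)
Definition mode_operator (P : setting) (lam : R) (u : nat -> R -> R) (y : R) : R :=
  lam * visc P * (u 4%nat y - 2 * wave P ^ 2 * u 2%nat y + wave P ^ 4 * u 0%nat y)
  + lam ^ 2 * (wave P ^ 2 * dens P y * u 0%nat y - ddens P y * u 1%nat y
               - dens P y * u 2%nat y)
  - grav P * wave P ^ 2 * ddens P y * u 0%nat y.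

Definition mode_bc (P : setting) : (nat -> R -> R) -> Prop :=
  slip_bc (- slip0 P / visc P) (slip1 P / visc P).

(** All integrations by parts are done at once: the form density minus [mode_operator] times the
    test function is the derivative of an explicit [W]. *)
Lemma weak_form (P : setting) (lam : R) (f : R -> R) (u p : nat -> R -> R) :
  chain 4 u -> mode_bc P u -> (forall y, 0 <= y <= 1 -> mode_operator P lam u y = f y) ->
  test_function p -> cont f ->
  form P lam u p = RInt (fun y => f y * p 0%nat y) 0 1.
Proof.
intros Cu [_ [_ [B0 B1]]] Eu [Cp [Z0 Z1]] Hf.
assert (Cu2 : chain 2 u) by (apply (chain_le 2 4); [assumption | lia]).
destruct (cont_chain2 p Cp) as [P0 [P1 P2]].
set (W := fun y => lam * visc P * (u 2%nat y * p 1%nat y - u 3%nat y * p 0%nat y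
                     + 2 * wave P ^ 2 * (u 1%nat y * p 0%nat y))
  + lam ^ 2 * (dens P y * (u 1%nat y * p 0%nat y))
  - lam * ((slip1 P * y - slip0 P * (1 - y)) * (u 1%nat y * p 1%nat y))).
set (W' := fun y => form_density P lam u p y - mode_operator P lam u y * p 0%nat y).
assert (CW' : cont W').
{ assert (C0 := chain_cont 4 0 u Cu ltac:(lia)). assert (C1 := chain_cont 4 1 u Cu ltac:(lia)).
  assert (C2 := chain_cont 4 2 u Cu ltac:(lia)). assert (C4 := chain_cont 4 4 u Cu ltac:(lia)).
  assert (C5 := cont_form_density P lam u p Cu2 Cp).
  assert (Hr := dens_cont P). assert (Hd := ddens_cont P).
  unfold W', mode_operator. cont. }
assert (HW : RInt W' 0 1 = W 1 - W 0).
{ apply FTC; [| assumption]. intros y.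
  assert (U0 := proj1 Cu 0%nat ltac:(lia)). assert (U1 := proj1 Cu 1%nat ltac:(lia)).
  assert (U2 := proj1 Cu 2%nat ltac:(lia)). assert (U3 := proj1 Cu 3%nat ltac:(lia)).
  assert (D0 := proj1 Cp 0%nat ltac:(lia)). assert (D1 := proj1 Cp 1%nat ltac:(lia)).
  assert (Dr := dens_derive P).
  eapply is_derive_eq.
  - unfold W. derive.
  - unfold W', form_density, inertia, dissipation, buoyancy, mode_operator, slip_weight. ring. }
(* Where [p 0] vanishes, only lam p' (mu u'' - slip_weight u') remains of [W], which is zero by the
   slip conditions. *)
assert (Hbd : W 1 - W 0 = 0).
{ assert (Hv := visc_pos P). unfold W. rewrite Z0, Z1, B0, B1. field. lra. }
rewrite Hbd in HW.
unfold W' in HW. rewrite cont_RInt_minus in HW.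
- unfold form.
  assert (E : RInt (fun y => mode_operator P lam u y * p 0%nat y) 0 1
              = RInt (fun y => f y * p 0%nat y) 0 1).
  { apply RInt_ext_01. intros y Hy.
    rewrite Eu by lra. reflexivity. }
  rewrite <- E. lra.
- now apply cont_form_density.
- assert (C0 := chain_cont 4 0 u Cu ltac:(lia)). assert (C1 := chain_cont 4 1 u Cu ltac:(lia)).
  assert (C2 := chain_cont 4 2 u Cu ltac:(lia)). assert (C4 := chain_cont 4 4 u Cu ltac:(lia)).
  assert (Hr := dens_cont P). assert (Hd := ddens_cont P).
  unfold mode_operator. cont.
Qed.

Lemma cross_term_bound (a M p q : R) : Rabs a <= M -> Rabs (a * (p * q)) <= M * (p ^ 2 + q ^ 2).
Proof.
intros Ha. rewrite !Rabs_mult.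
assert (K1 : Rabs p * Rabs q <= p ^ 2 + q ^ 2).
{ rewrite <- (pow2_abs p), <- (pow2_abs q).
  assert (0 <= (Rabs p - Rabs q) ^ 2) by apply pow2_ge_0.
  assert (0 <= Rabs p * Rabs q) by (apply Rmult_le_pos; apply Rabs_pos). nra. }
apply Rmult_le_compat; try assumption; [apply Rabs_pos |].
apply Rmult_le_pos; apply Rabs_pos.
Qed.

Lemma slip_weight_bound (P : setting) (y : R) : 0 <= y <= 1 ->
  Rabs (slip_weight P y) <= Rabs (slip0 P) + Rabs (slip1 P).
Proof.
intros Hy; unfold slip_weight.
assert (H := Rabs_triang (slip1 P * y) (- (slip0 P * (1 - y)))).
rewrite Rabs_Ropp, !Rabs_mult, (Rabs_pos_eq y), (Rabs_pos_eq (1 - y)) in H by lra.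
assert (0 <= Rabs (slip0 P)) by apply Rabs_pos. assert (0 <= Rabs (slip1 P)) by apply Rabs_pos.
unfold Rminus at 1. nra.
Qed.

(* Young's inequality on the cross term, with half of the viscous term to spare. *)
Lemma form_density_lower (P : setting) : exists K, 0 < K /\
  forall lam p y, 0 < lam -> 0 <= y <= 1 ->
  lam * visc P / 2 * p 2%nat y ^ 2
  + lam ^ 2 * dens P y * (wave P ^ 2 * p 0%nat y ^ 2 + p 1%nat y ^ 2)
  - lam * K * p 1%nat y ^ 2 - K * p 0%nat y ^ 2 <= form_density P lam p p y.
Proof.
destruct (cont_bounded (ddens P) (ddens_cont P)) as [M [HM BM]].
assert (Hmu := visc_pos P). assert (Hk := wave_pos P). assert (Hg := grav_pos P).
set (m := Rabs (slip0 P) + Rabs (slip1 P)).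
assert (Hm0 : 0 <= m) by (apply Rplus_le_le_0_compat; apply Rabs_pos).
assert (Hk2 : 0 < wave P ^ 2) by (apply pow_lt; lra).
assert (Hk4 : 0 < wave P ^ 4) by (apply pow_lt; lra).
assert (Hq : 0 <= 2 * m ^ 2 / visc P).
{ apply Rmult_le_pos; [nra | left; now apply Rinv_0_lt_compat]. }
assert (HG : 0 < grav P * wave P ^ 2 * M)
  by (apply Rmult_lt_0_compat; [apply Rmult_lt_0_compat |]; lra).
(* The slip terms cost m + 2 m^2/mu on p'^2, the buoyancy g k^2 M on p^2. The constant is fixed
   before [lam], so that lam^2 can later beat lam K. *)
exists (m + 2 * m ^ 2 / visc P + grav P * wave P ^ 2 * M + 1). split; [lra |].
intros lam p y Hlam Hy.
set (K := m + 2 * m ^ 2 / visc P + grav P * wave P ^ 2 * M + 1).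
set (p0 := p 0%nat y). set (p1 := p 1%nat y). set (p2 := p 2%nat y).
assert (S0 : 0 <= p0 ^ 2) by apply pow2_ge_0.
assert (S1 : 0 <= p1 ^ 2) by apply pow2_ge_0.
assert (S2 : 0 <= p2 ^ 2) by apply pow2_ge_0.
assert (HB : grav P * wave P ^ 2 * ddens P y * p0 ^ 2 <= grav P * wave P ^ 2 * M * p0 ^ 2).
{ apply Rmult_le_compat_r; [assumption |]. apply Rmult_le_compat_l; [nra |].
  apply Rle_trans with (Rabs (ddens P y)); [apply Rle_abs | now apply BM]. }
assert (Hs : (slip0 P + slip1 P) * p1 ^ 2 <= m * p1 ^ 2).
{ apply Rmult_le_compat_r; [assumption |].
  unfold m; assert (H1 := Rle_abs (slip0 P)); assert (H2 := Rle_abs (slip1 P)); lra. }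
assert (Hy2 : 2 * (slip_weight P y * (p1 * p2))
          <= visc P / 2 * p2 ^ 2 + 2 * m ^ 2 / visc P * p1 ^ 2).
{ set (w := slip_weight P y).
  assert (Hw : w ^ 2 <= m ^ 2) by (apply pow_maj_Rabs; now apply slip_weight_bound).
  apply Rle_trans with (visc P / 2 * p2 ^ 2 + 2 * w ^ 2 / visc P * p1 ^ 2).
  - assert (E : visc P / 2 * p2 ^ 2 + 2 * w ^ 2 / visc P * p1 ^ 2 - 2 * (w * (p1 * p2))
      = visc P / 2 * (p2 - 2 * w * p1 / visc P) ^ 2) by (field; lra).
    assert (0 <= visc P / 2 * (p2 - 2 * w * p1 / visc P) ^ 2) by
      (apply Rmult_le_pos; [lra | apply pow2_ge_0]). lra.
  - apply Rplus_le_compat_l, Rmult_le_compat_r; [assumption |].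
    apply Rmult_le_compat_r; [left; now apply Rinv_0_lt_compat | lra]. }
unfold form_density, inertia, dissipation, buoyancy. fold p0 p1 p2.
set (w := slip_weight P y) in *.
assert (HV : visc P / 2 * p2 ^ 2 - (m + 2 * m ^ 2 / visc P) * p1 ^ 2 <=
  visc P * (p2 * p2 + 2 * wave P ^ 2 * (p1 * p1) + wave P ^ 4 * (p0 * p0))
  - ((slip0 P + slip1 P) * (p1 * p1) + w * (p1 * p2 + p2 * p1))).
{ assert (0 <= visc P * (2 * wave P ^ 2 * p1 ^ 2)) by (apply Rmult_le_pos; [lra | apply Rmult_le_pos; lra]).
  assert (0 <= visc P * (wave P ^ 4 * p0 ^ 2)) by (apply Rmult_le_pos; [lra | apply Rmult_le_pos; lra]).
  lra. }
apply (Rmult_le_compat_l lam) in HV; [| lra].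
assert (HK1 : lam * ((m + 2 * m ^ 2 / visc P) * p1 ^ 2) <= lam * (K * p1 ^ 2)).
{ apply Rmult_le_compat_l; [lra |]. apply Rmult_le_compat_r; [assumption | unfold K; lra]. }
assert (HK0 : grav P * wave P ^ 2 * M * p0 ^ 2 <= K * p0 ^ 2).
{ apply Rmult_le_compat_r; [assumption | unfold K; lra]. }
lra.
Qed.

(** * Energy estimates for the quadratic form *)

Lemma cont_energy_density (p : nat -> R -> R) : chain 2 p ->
  cont (fun y => p 0%nat y ^ 2 + p 1%nat y ^ 2 + p 2%nat y ^ 2).
Proof. intros Hp; destruct (cont_chain2 p Hp) as [P0 [P1 P2]]; cont. Qed.

Lemma energy_nonneg (p : nat -> R -> R) : chain 2 p -> 0 <= energy p.
Proof.
intros Hp; apply cont_RInt_ge_0; [lra | now apply cont_energy_density |].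
intros y _; repeat apply Rplus_le_le_0_compat; apply pow2_ge_0.
Qed.

(* [p'^2] is absorbed through the null Lagrangian [(p p')' = p'^2 + p p'']. *)
Lemma garding (P : setting) (lam : R) : 0 < lam ->
  exists c C, 0 < c /\ 0 < C /\
  forall p, test_function p -> c * energy p <= form P lam p p + C * mass p.
Proof.
intros Hlam.
destruct (form_density_lower P) as [K [HK HL]].
destruct (dens_lower P) as [r [Hr Br]].
assert (Hmu := visc_pos P).
assert (Hlm : 0 < lam * visc P) by now apply Rmult_lt_0_compat.
(* The part lam K repays the loss in p'^2, and the 1 leaves c p'^2 to spare since c <= 1. *)
set (C1 := lam * K + 1).
assert (HC1 : 0 < C1) by (unfold C1; nra).
set (c := Rmin (lam * visc P / 4) 1).
assert (Hc : 0 < c /\ c <= lam * visc P / 4 /\ c <= 1).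
{ unfold c; repeat split; [apply Rmin_glb_lt; lra | apply Rmin_l | apply Rmin_r]. }
(* The middle term is the price of absorbing C1 p p'' into a quarter of the viscous term. *)
set (C := K + C1 ^ 2 / (lam * visc P) + 1).
assert (HC : 0 < C).
{ unfold C. assert (0 <= C1 ^ 2 / (lam * visc P)); [| lra].
  apply Rmult_le_pos; [apply pow2_ge_0 | left; now apply Rinv_0_lt_compat]. }
exists c, C; split; [apply Hc | split; [assumption |]].
intros p [Cp [Z0 Z1]].
destruct (cont_chain2 p Cp) as [P0 [P1 P2]].
(* This integral vanishes because [p] is zero at both ends, so [C1] times it can be added to the
   form for free. *)
assert (HN : 0 = RInt (fun y => p 1%nat y * p 1%nat y + p 0%nat y * p 2%nat y) 0 1).
{ rewrite (FTC (fun y => p 0%nat y * p 1%nat y)).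
  - rewrite Z0, Z1; ring.
  - intros y.
    assert (D0 := proj1 Cp 0%nat ltac:(lia)). assert (D1 := proj1 Cp 1%nat ltac:(lia)).
    derive.
  - cont. }
assert (HI : RInt (fun y => c * (p 0%nat y ^ 2 + p 1%nat y ^ 2 + p 2%nat y ^ 2)) 0 1 <=
  RInt (fun y => 1 * form_density P lam p p y + C * p 0%nat y ^ 2
    + C1 * (p 1%nat y * p 1%nat y + p 0%nat y * p 2%nat y)) 0 1).
{ assert (CF := cont_form_density P lam p p Cp Cp).
  apply cont_RInt_le; [lra | cont | cont |]. intros y Hy.
  assert (HL' := HL lam p y Hlam ltac:(lra)).
  assert (Hry := Br y ltac:(lra)). assert (Hk := wave_pos P).
  set (p0 := p 0%nat y) in *. set (p1 := p 1%nat y) in *. set (p2 := p 2%nat y) in *.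
  assert (0 <= lam ^ 2 * dens P y * (wave P ^ 2 * p0 ^ 2 + p1 ^ 2)).
  { assert (0 <= wave P ^ 2) by apply pow2_ge_0. assert (0 <= p0 ^ 2) by apply pow2_ge_0.
    assert (0 <= p1 ^ 2) by apply pow2_ge_0. apply Rmult_le_pos; [| nra].
    apply Rmult_le_pos; [apply pow2_ge_0 | lra]. }
  assert (HY : 0 <= lam * visc P / 4 * p2 ^ 2 + C1 * (p0 * p2)
                    + C1 ^ 2 / (lam * visc P) * p0 ^ 2).
  { replace (lam * visc P / 4 * p2 ^ 2 + C1 * (p0 * p2) + C1 ^ 2 / (lam * visc P) * p0 ^ 2)
      with (lam * visc P / 4 * (p2 + 2 * C1 * p0 / (lam * visc P)) ^ 2) by (field; lra).
    apply Rmult_le_pos; [lra | apply pow2_ge_0]. }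
  assert (c * p2 ^ 2 <= lam * visc P / 4 * p2 ^ 2) by
    (apply Rmult_le_compat_r; [apply pow2_ge_0 | lra]).
  assert (c * p1 ^ 2 <= 1 * p1 ^ 2) by (apply Rmult_le_compat_r; [apply pow2_ge_0 | lra]).
  assert (c * p0 ^ 2 <= 1 * p0 ^ 2) by (apply Rmult_le_compat_r; [apply pow2_ge_0 | lra]).
  unfold C, C1 in *. lra. }
rewrite cont_RInt_scal in HI by now apply cont_energy_density.
rewrite RInt_lincomb3 in HI; [| now apply cont_form_density | cont | cont].
rewrite <- HN in HI. unfold energy, form, mass. lra.
Qed.

(** These bounds control the change of the form under a change of rate, in which the buoyancy
    cancels. *)
Lemma form_parts_bound (P : setting) : exists K, 0 < K /\
  forall p, chain 2 p ->
  Rabs (RInt (inertia P p p) 0 1) <= K * energy p /\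
  Rabs (RInt (dissipation P p p) 0 1) <= K * energy p.
Proof.
destruct (cont_bounded (dens P) (dens_cont P)) as [M [HM BM]].
assert (Hmu := visc_pos P). assert (Hk := wave_pos P).
set (m := Rabs (slip0 P) + Rabs (slip1 P)).
assert (Hm0 : 0 <= m) by (apply Rplus_le_le_0_compat; apply Rabs_pos).
assert (Hk2 : 0 < wave P ^ 2) by (apply pow_lt; lra).
assert (Hk4 : 0 < wave P ^ 4) by (apply pow_lt; lra).
set (k2 := wave P ^ 2) in *. set (k4 := wave P ^ 4) in *.
set (K := M * (k2 + 1) + visc P * (1 + 2 * k2 + k4) + m + 4 * m).
assert (HMk : 0 < M * (k2 + 1)) by (apply Rmult_lt_0_compat; lra).
assert (Hvk : 0 < visc P * (1 + 2 * k2 + k4)) by (apply Rmult_lt_0_compat; lra).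
exists K; split; [unfold K; lra |]. intros p Cp.
destruct (cont_densities P p p Cp Cp) as [C1 [C2 _]].
assert (CE := cont_energy_density p Cp).
assert (Hgen : forall f, cont f ->
  (forall y, 0 <= y <= 1 ->
    Rabs (f y) <= K * (p 0%nat y ^ 2 + p 1%nat y ^ 2 + p 2%nat y ^ 2)) ->
  Rabs (RInt f 0 1) <= K * energy p).
{ intros f Cf Hf.
  apply Rle_trans with (RInt (fun y => Rabs (f y)) 0 1).
  - apply abs_RInt_le; [lra | now apply cont_ex_RInt].
  - unfold energy. rewrite <- cont_RInt_scal by assumption.
    apply cont_RInt_le; [lra | now apply (cont_comp f Rabs Cf cont_abs)
      | apply (cont_mult (fun _ => K)); [apply cont_const | exact CE] |].
    intros y Hy; apply Hf; lra. }
split; apply Hgen; try assumption; intros y Hy;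
  set (p0 := p 0%nat y); set (p1 := p 1%nat y); set (p2 := p 2%nat y);
  assert (S0 : 0 <= p0 ^ 2) by apply pow2_ge_0;
  assert (S1 : 0 <= p1 ^ 2) by apply pow2_ge_0;
  assert (S2 : 0 <= p2 ^ 2) by apply pow2_ge_0.
- unfold inertia; fold p0 p1 p2 k2. rewrite Rabs_mult.
  apply Rle_trans with (M * ((k2 + 1) * (p0 ^ 2 + p1 ^ 2 + p2 ^ 2))).
  + apply Rmult_le_compat; try apply Rabs_pos; [now apply BM |].
    rewrite Rabs_pos_eq by nra. nra.
  + rewrite <- Rmult_assoc. apply Rmult_le_compat_r; [lra | unfold K; lra].
- unfold dissipation; fold p0 p1 p2 k2 k4. set (w := slip_weight P y).
  assert (Hw : Rabs w <= m) by now apply slip_weight_bound.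
  assert (T1 := cross_term_bound w m p1 p2 Hw).
  assert (Hs : Rabs (slip0 P + slip1 P) <= m) by apply Rabs_triang.
  assert (T2 : Rabs ((slip0 P + slip1 P) * p1 ^ 2) <= m * p1 ^ 2).
  { rewrite Rabs_mult, (Rabs_pos_eq (p1 ^ 2)) by assumption.
    now apply Rmult_le_compat_r. }
  apply Rabs_le_between in T1. apply Rabs_le_between in T2.
  set (E := p0 ^ 2 + p1 ^ 2 + p2 ^ 2).
  assert (T3 : 0 <= visc P * (p2 * p2 + 2 * k2 * (p1 * p1) + k4 * (p0 * p0))
               <= visc P * (1 + 2 * k2 + k4) * E).
  { rewrite (Rmult_assoc (visc P) (1 + 2 * k2 + k4) E). split.
    - apply Rmult_le_pos; [lra | nra].
    - apply Rmult_le_compat_l; [lra |]. unfold E. nra. }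
  assert (T4 : m * p1 ^ 2 <= m * E) by (apply Rmult_le_compat_l; unfold E; lra).
  assert (T5 : m * (p1 ^ 2 + p2 ^ 2) <= m * E) by (apply Rmult_le_compat_l; unfold E; lra).
  assert (T6 : 0 <= M * (k2 + 1) * E) by (apply Rmult_le_pos; unfold E; lra).
  assert (T7 : 0 <= m * E) by (apply Rmult_le_pos; unfold E; lra).
  apply Rabs_le_between. unfold K. lra.
Qed.

(** Already the density is nonnegative: with r <= rho, lam >= K/r pays for p'^2, and lam >= 1 with
    lam >= K/(r k^2) pays for p^2. *)
Lemma form_nonneg_large (P : setting) : exists Lam, 0 < Lam /\
  forall lam p, Lam <= lam -> chain 2 p -> 0 <= form P lam p p.
Proof.
destruct (form_density_lower P) as [K [HK HL]].
destruct (dens_lower P) as [r [Hr Br]].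
assert (Hk := wave_pos P). assert (Hmu := visc_pos P).
assert (Hk2 : 0 < wave P ^ 2) by (apply pow_lt; lra).
assert (Hrk : 0 < r * wave P ^ 2) by now apply Rmult_lt_0_compat.
assert (H1 : 0 < K / r) by now apply Rdiv_lt_0_compat.
assert (H2 : 0 < K / (r * wave P ^ 2)) by now apply Rdiv_lt_0_compat.
exists (1 + K / r + K / (r * wave P ^ 2)). split; [lra |].
intros lam p Hlam Cp.
apply cont_RInt_ge_0; [lra | now apply cont_form_density |]. intros y Hy.
eapply Rle_trans; [| apply HL; lra].
assert (Hry := Br y ltac:(lra)).
set (p0 := p 0%nat y). set (p1 := p 1%nat y). set (p2 := p 2%nat y).
assert (S0 : 0 <= p0 ^ 2) by apply pow2_ge_0.
assert (S1 : 0 <= p1 ^ 2) by apply pow2_ge_0.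
assert (S2 : 0 <= p2 ^ 2) by apply pow2_ge_0.
assert (Kr : K <= lam * r).
{ replace K with (K / r * r) by (field; lra). apply Rmult_le_compat_r; lra. }
assert (Krk : K <= lam * (r * wave P ^ 2)).
{ replace K with (K / (r * wave P ^ 2) * (r * wave P ^ 2)) by (field; lra).
  apply Rmult_le_compat_r; lra. }
assert (T1 : lam * K * p1 ^ 2 <= lam ^ 2 * dens P y * p1 ^ 2).
{ apply Rmult_le_compat_r; [assumption |].
  replace (lam ^ 2 * dens P y) with (lam * (lam * dens P y)) by ring.
  apply Rmult_le_compat_l; [lra |]. nra. }
assert (T0 : K * p0 ^ 2 <= lam ^ 2 * dens P y * (wave P ^ 2 * p0 ^ 2)).
{ rewrite <- Rmult_assoc. apply Rmult_le_compat_r; [assumption |].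
  apply Rle_trans with (lam * (r * wave P ^ 2)); [assumption |].
  replace (lam ^ 2 * dens P y * wave P ^ 2) with (lam * (lam * (dens P y * wave P ^ 2))) by ring.
  apply Rmult_le_compat_l; [lra |].
  apply Rle_trans with (1 * (dens P y * wave P ^ 2)); [nra |].
  apply Rmult_le_compat_r; [nra | lra]. }
assert (0 <= lam * visc P / 2 * p2 ^ 2) by (apply Rmult_le_pos; nra).
lra.
Qed.

(** * C^2 bumps supported in a given interval *)

Lemma is_derive_of_quadratic_error (f : R -> R) (x l C : R) :
  (forall y, Rabs (f y - f x - l * (y - x)) <= C * (y - x) ^ 2) -> is_derive f x l.
Proof.
intros H. apply is_derive_Reals. intros e He.
assert (HC : 0 <= C).
{ specialize (H (x + 1)). replace (x + 1 - x) with 1 in H by ring.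
  assert (H0 := Rabs_pos (f (x + 1) - f x - l * 1)). lra. }
assert (Hd : 0 < e / (C + 1)) by (apply Rdiv_lt_0_compat; lra).
exists (mkposreal _ Hd). intros h Hh0 Hh. simpl in Hh.
specialize (H (x + h)). replace (x + h - x) with h in H by ring.
replace ((f (x + h) - f x) / h - l) with ((f (x + h) - f x - l * h) / h) by (field; assumption).
unfold Rdiv; rewrite Rabs_mult, Rabs_inv.
assert (Hah : 0 < Rabs h) by now apply Rabs_pos_lt.
apply Rle_lt_trans with (C * Rabs h).
- apply Rmult_le_reg_r with (Rabs h); [assumption |].
  rewrite Rmult_assoc, Rinv_l, Rmult_1_r by lra.
  rewrite <- pow2_abs in H. lra.
- apply Rle_lt_trans with ((C + 1) * Rabs h); [apply Rmult_le_compat_r; lra |].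
  apply (Rmult_lt_compat_l (C + 1)) in Hh; [| lra].
  replace ((C + 1) * (e / (C + 1))) with e in Hh by (field; lra). exact Hh.
Qed.

Definition pos_part (z : R) : R := Rmax 0 z.

Lemma pos_part_cases (z : R) : 0 <= z /\ pos_part z = z \/ z < 0 /\ pos_part z = 0.
Proof. unfold pos_part, Rmax; destruct (Rle_dec 0 z); [left | right]; lra. Qed.

Lemma cont_pos_part : cont pos_part.
Proof.
assert (E : forall z, pos_part z = (z + Rabs z) / 2).
{ intros z; unfold pos_part, Rmax; destruct Rle_dec; split_Rabs; lra. }
intros x. apply (continuous_ext (fun z => (z + Rabs z) / 2)).
- intros z; now rewrite E.
- unfold Rdiv. assert (Ha := cont_abs). assert (H : cont (fun z => (z + Rabs z) * / 2)) by cont.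
  apply H.
Qed.

(** The error of the linear approximation is at most (y - z)^2 in every sign case, which treats the
    kink at 0 like any other point. *)
Lemma pos_part_sq_derive (z : R) : is_derive (fun t => pos_part t ^ 2) z (2 * pos_part z).
Proof.
apply (is_derive_of_quadratic_error _ _ _ 1). intros y.
assert (H := pow2_ge_0 (y - z)).
destruct (pos_part_cases y) as [[Hy ->] | [Hy ->]], (pos_part_cases z) as [[Hz ->] | [Hz ->]];
  apply Rabs_le_between; split; nra.
Qed.

Lemma pos_part_cube_derive (z : R) : is_derive (fun t => pos_part t ^ 3) z (3 * pos_part z ^ 2).
Proof.
apply (is_derive_ext (fun t => t * pos_part t ^ 2)).
- intros t. change (t * pos_part t ^ 2 = pos_part t ^ 3).
  destruct (pos_part_cases t) as [[_ ->] | [_ ->]]; ring.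
- eapply is_derive_eq.
  + apply (derive_mult (fun t => t)); [apply derive_id | apply pos_part_sq_derive].
  + destruct (pos_part_cases z) as [[_ ->] | [_ ->]]; ring.
Qed.

Lemma derive_comp (f h : R -> R) (x l m : R) :
  is_derive h (f x) m -> is_derive f x l -> is_derive (fun t => h (f t)) x (l * m).
Proof. intros H1 H2; exact (is_derive_comp h f x m l H1 H2). Qed.

(** The cube of the positive part of the parabola (y - a)(b - y): the third power is the smallest
    that is C^2. *)
Lemma bump_exists (a b : R) : 0 < a -> a < b -> b < 1 ->
  exists p, test_function p /\
    (forall y, a < y < b -> 0 < p 0%nat y) /\ (forall y, ~ a < y < b -> p 0%nat y = 0).
Proof.
intros Ha Hab Hb.
set (z := fun y => (y - a) * (b - y)).
set (z' := fun y => a + b - 2 * y).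
assert (Dz : forall y, is_derive z y (z' y)).
{ intros y; eapply is_derive_eq; [unfold z; derive | unfold z'; ring]. }
assert (Hpos : forall y, a < y < b -> 0 < z y).
{ intros y Hy; unfold z; apply Rmult_lt_0_compat; lra. }
assert (Hneg : forall y, ~ a < y < b -> z y <= 0).
{ intros y Hy; unfold z. destruct (Rle_dec y a); [nra |].
  assert (b <= y) by (apply Rnot_lt_le; intros K; apply Hy; lra). nra. }
set (p0 := fun y => pos_part (z y) ^ 3).
set (p1 := fun y => z' y * (3 * pos_part (z y) ^ 2)).
set (p2 := fun y => - 2 * (3 * pos_part (z y) ^ 2) + z' y * (3 * (z' y * (2 * pos_part (z y))))).
assert (D0 : forall y, is_derive p0 y (p1 y)).
{ intros y. apply (derive_comp z (fun t => pos_part t ^ 3)); [apply pos_part_cube_derive | apply Dz]. }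
assert (D1 : forall y, is_derive p1 y (p2 y)).
{ intros y. unfold p1, p2.
  assert (Ds : forall t, is_derive (fun t => pos_part (z t) ^ 2) t (z' t * (2 * pos_part (z t)))).
  { intros t. apply (derive_comp z (fun t => pos_part t ^ 2)); [apply pos_part_sq_derive | apply Dz]. }
  assert (Dz' : forall t, is_derive z' t (- 2)).
  { intros t; eapply is_derive_eq; [unfold z'; derive | ring]. }
  eapply is_derive_eq.
  - apply (derive_mult z' (fun t => 3 * pos_part (z t) ^ 2)); [apply Dz' |].
    apply (derive_mult (fun _ => 3) (fun t => pos_part (z t) ^ 2));
      [apply derive_const | apply Ds].
  - ring. }
assert (C2 : cont p2).
{ assert (Cz := cont_derive z z' Dz). assert (Cz' : cont z') by (unfold z'; cont).
  assert (Cp := cont_comp z pos_part Cz cont_pos_part). unfold p2. cont. }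
exists (fun i => match i with 0%nat => p0 | 1%nat => p1 | _ => p2 end).
split; [split; [split | split] | split].
- intros i Hi; destruct i as [|[|i]]; [assumption | assumption | lia].
- assumption.
- unfold p0, pos_part. rewrite Rmax_left; [ring | apply Hneg; lra].
- unfold p0, pos_part. rewrite Rmax_left; [ring | apply Hneg; lra].
- intros y Hy. unfold p0, pos_part. specialize (Hpos y Hy).
  rewrite Rmax_right by lra. now apply pow_lt.
- intros y Hy. unfold p0, pos_part. rewrite Rmax_left; [ring | now apply Hneg].
Qed.

Lemma form_negative_somewhere (P : setting) : exists lam p,
  0 < lam /\ test_function p /\ form P lam p p < 0.
Proof.
destruct (ddens_pos_somewhere P) as [y0 [Hy0 Hp0]].
assert (Hloc : locally y0 (fun y => 0 < ddens P y)).
{ apply (ddens_cont P y0 (fun z => 0 < z)). now apply open_gt. }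
destruct Hloc as [d Hd]. assert (Hd0 := cond_pos d).
set (e := Rmin (d / 2) (Rmin (y0 / 2) ((1 - y0) / 2))).
assert (He : 0 < e /\ e < d /\ e < y0 /\ e < 1 - y0).
{ unfold e; repeat split; unfold Rmin; repeat destruct Rle_dec; lra. }
destruct (bump_exists (y0 - e) (y0 + e)) as [p [Hp [Hin Hout]]]; [lra .. |].
assert (Cp := proj1 Hp).
destruct (cont_densities P p p Cp Cp) as [_ [_ CB]].
assert (Hgk : 0 < grav P * wave P ^ 2).
{ apply Rmult_lt_0_compat; [apply grav_pos | apply pow_lt, wave_pos]. }
assert (Hpos : forall y, y0 - e < y < y0 + e -> 0 < buoyancy P p p y).
{ intros y Hy. unfold buoyancy. specialize (Hin y Hy).
  assert (0 < ddens P y) by (apply Hd; change (Rabs (y - y0) < d); apply Rabs_def1; lra).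
  apply Rmult_lt_0_compat; now apply Rmult_lt_0_compat. }
assert (HG : 0 < RInt (buoyancy P p p) 0 1).
{ apply (RInt_gt_0_at _ 0 1 y0); [assumption | | lra | apply Hpos; lra].
  intros y Hy. destruct (Rlt_dec (y0 - e) y) as [H1 |H1]; [destruct (Rlt_dec y (y0 + e)) as [H2|H2] |].
  - left; apply Hpos; lra.
  - right; unfold buoyancy; rewrite (Hout y) by lra; ring.
  - right; unfold buoyancy; rewrite (Hout y) by lra; ring. }
set (A := RInt (inertia P p p) 0 1). set (B := RInt (dissipation P p p) 0 1).
set (G := RInt (buoyancy P p p) 0 1) in *.
assert (HA := Rabs_pos A). assert (HB := Rabs_pos B).
assert (HA' := Rle_abs A). assert (HB' := Rle_abs B).
(* With lam <= 1, lam^2 A + lam B is at most lam (|A| + |B|), strictly below the buoyancy integral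
   [G]. *)
set (lam := Rmin 1 (G / (Rabs A + Rabs B + 1))).
assert (Hl : 0 < lam) by (apply Rmin_glb_lt; [lra | apply Rdiv_lt_0_compat; lra]).
assert (Hl1 : lam <= 1) by apply Rmin_l.
assert (Hl2 : lam * (Rabs A + Rabs B + 1) <= G).
{ replace G with (G / (Rabs A + Rabs B + 1) * (Rabs A + Rabs B + 1)) at 1 by (field; lra).
  apply Rmult_le_compat_r; [lra | apply Rmin_r]. }
exists lam, p. split; [assumption | split; [assumption |]].
rewrite form_expand by assumption. fold A B G.
assert (lam ^ 2 * A <= lam * Rabs A).
{ apply Rle_trans with (lam ^ 2 * Rabs A).
  - apply Rmult_le_compat_l; [apply pow2_ge_0 | assumption].
  - apply Rmult_le_compat_r; [assumption | nra]. }
assert (lam * B <= lam * Rabs B) by (apply Rmult_le_compat_l; lra).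
lra.
Qed.

(** For a fixed test function the form is a polynomial in the rate: a negative value at the supremum
    would persist slightly above it. *)
Lemma critical_rate (P : setting) : exists lam, 0 < lam /\
  (forall p, test_function p -> 0 <= form P lam p p) /\
  (forall d, 0 < d -> exists lam' p, 0 < lam' /\ lam - d < lam' <= lam /\
     test_function p /\ form P lam' p p < 0).
Proof.
destruct (form_nonneg_large P) as [Lam [HLam HL]].
destruct (form_negative_somewhere P) as [lam0 [p0 [Hl0 [Hp0 Hneg0]]]].
set (E := fun lam => 0 < lam /\ exists p, test_function p /\ form P lam p p < 0).
destruct (completeness E) as [lam [Hub Hlub]].
- exists Lam. intros x [Hx [p [Hp Hn]]].
  destruct (Rle_dec x Lam) as [| Hx']; [assumption |].
  assert (0 <= form P x p p) by (apply HL; [lra | apply Hp]). lra.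
- exists lam0. split; [assumption | now exists p0].
- assert (Hlam : 0 < lam).
  { apply Rlt_le_trans with lam0; [assumption |]. apply Hub. split; [assumption | now exists p0]. }
  exists lam; split; [assumption | split].
  + intros p Hp. destruct (Rle_dec 0 (form P lam p p)) as [|Hn]; [assumption | exfalso].
    apply Rnot_le_lt in Hn.
    assert (Cp := proj1 Hp).
    set (A := RInt (inertia P p p) 0 1). set (B := RInt (dissipation P p p) 0 1).
    set (q := form P lam p p) in *.
    assert (HA := Rabs_pos A). assert (HB := Rabs_pos B).
    assert (HA' := Rle_abs A). assert (HB' := Rle_abs B).
    (* For d <= 1 the form grows by at most d S from [lam] to lam + d, and d S <= - q/2 keeps it
       negative. *)
    set (S := (2 * lam + 1) * Rabs A + Rabs B + 1).
    assert (HS : 0 < S) by (unfold S; nra).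
    set (d := Rmin 1 (- q / (2 * S))).
    assert (Hd : 0 < d) by (apply Rmin_glb_lt; [lra | apply Rdiv_lt_0_compat; lra]).
    assert (Hd1 : d <= 1) by apply Rmin_l.
    assert (Hd2 : d * S <= - q / 2).
    { replace (- q / 2) with (- q / (2 * S) * S) by (field; lra).
      apply Rmult_le_compat_r; [lra | apply Rmin_r]. }
    assert (HE : E (lam + d)).
    { split; [lra |]. exists p; split; [assumption |].
      assert (Hq : form P (lam + d) p p = q + d * ((2 * lam + d) * A + B)).
      { unfold q. rewrite !form_expand by assumption. fold A B. ring. }
      rewrite Hq.
      assert ((2 * lam + d) * A <= (2 * lam + 1) * Rabs A).
      { apply Rle_trans with ((2 * lam + d) * Rabs A);
          [apply Rmult_le_compat_l; lra | apply Rmult_le_compat_r; lra]. }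
      assert (d * ((2 * lam + d) * A + B) <= d * S); [| lra].
      apply Rmult_le_compat_l; [lra | unfold S; lra]. }
    assert (H := Hub _ HE). lra.
  + intros d Hd.
    destruct (classic (exists x, E x /\ lam - d < x)) as [[x [[Hx [p [Hp Hn]]] Hxd]] | Hno].
    * exists x, p. split; [assumption | split; [| now split]].
      split; [assumption |]. apply Hub. split; [assumption | now exists p].
    * assert (Hle : lam <= lam - d); [| lra].
      apply Hlub. intros x Hx. apply Rnot_lt_le. intros Hlt. apply Hno. now exists x.
Qed.

(* A bounded inverse makes a nonnegative form coercive: test against the
   solution [u] of [mode_operator u = p] and minimise over [u + t p]. *)
Lemma coercive_of_inverse (P : setting) (lam M : R) : 0 < M ->
  (forall p, test_function p -> 0 <= form P lam p p) ->
  (forall f, cont f -> exists u, chain 4 u /\ mode_bc P u /\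
     (forall y, 0 <= y <= 1 -> mode_operator P lam u y = f y) /\
     RInt (fun y => u 0%nat y ^ 2) 0 1 <= M * RInt (fun y => f y ^ 2) 0 1) ->
  forall p, test_function p -> mass p <= (1 + M) / 2 * form P lam p p.
Proof.
intros HM Hpos Hinv p Hp.
assert (Cp := proj1 Hp). destruct (cont_chain2 p Cp) as [P0 [P1 P2]].
destruct (Hinv (p 0%nat) P0) as [u [Cu [Bu [Eu Iu]]]].
fold (mass p) in Iu.
assert (Cu2 : chain 2 u) by (apply (chain_le 2 4); [assumption | lia]).
assert (Tu : test_function u) by (split; [assumption | split; apply Bu]).
assert (E1 := weak_form P lam _ u p Cu Bu Eu Hp P0).
assert (E2 := weak_form P lam _ u u Cu Bu Eu Tu P0).
assert (C0 := proj1 (cont_chain2 u Cu2)).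
assert (E1' : form P lam u p = mass p).
{ rewrite E1. unfold mass. apply RInt_ext_01. intros; ring. }
(* Form(u,u) is the L^2 product of p and u, at most half of mass p + mass u, and mass u <= M mass
   p. *)
set (m := (1 + M) / 2).
assert (Hm : 0 < m) by (unfold m; lra).
assert (E2' : form P lam u u <= m * mass p).
{ rewrite E2.
  apply Rle_trans with (RInt (fun y => / 2 * p 0%nat y ^ 2 + / 2 * u 0%nat y ^ 2 + 0 * 0) 0 1).
  - apply cont_RInt_le; [lra | cont | cont |]. intros y _.
    assert (0 <= (p 0%nat y - u 0%nat y) ^ 2) by apply pow2_ge_0. nra.
  - rewrite (RInt_lincomb3 (/ 2) (/ 2) 0 (fun y => p 0%nat y ^ 2) (fun y => u 0%nat y ^ 2)
      (fun _ => 0)) by cont. fold (mass p). unfold m. lra. }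
(* At t = -m, nonnegativity reads 0 <= form(u,u) - 2 m mass p + m^2 form(p,p); inserting form(u,u)
   <= m mass p leaves mass p <= m form(p,p). *)
assert (HQ := form_quadratic P lam (- m) u p Cu2 Cp). simpl in HQ.
assert (Tv : test_function (fun i x => 1 * u i x + - m * p i x)).
{ split; [now apply chain_lincomb |].
  destruct Tu as [_ [U0 U1]]. destruct Hp as [_ [Q0 Q1]]. rewrite U0, U1, Q0, Q1. split; ring. }
specialize (Hpos _ Tv). rewrite HQ, E1' in Hpos.
assert (H : 0 <= m * (m * form P lam p p - mass p)) by nra.
apply Rmult_le_reg_l with m; [assumption |]. lra.
Qed.

(** With the mass bound, the Garding inequality becomes c energy <= (1 + C m) form, and a small
    change of rate moves the form by a small multiple of the energy. *)
Lemma form_nonneg_nearby (P : setting) (lam m : R) : 0 < lam -> 0 < m ->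
  (forall p, test_function p -> mass p <= m * form P lam p p) ->
  exists d, 0 < d /\ forall lam' p, 0 < lam' -> lam - d < lam' <= lam ->
    test_function p -> 0 <= form P lam' p p.
Proof.
intros Hlam Hm Hmass.
destruct (garding P lam Hlam) as [c [C [Hc [HC HG]]]].
destruct (form_parts_bound P) as [K [HK HKb]].
set (S := (1 + C * m) * (2 * lam + 1) * K).
assert (HCm : 0 < C * m) by now apply Rmult_lt_0_compat.
assert (HS : 0 < S) by (unfold S; repeat apply Rmult_lt_0_compat; lra).
exists (c / S). split; [now apply Rdiv_lt_0_compat |].
intros lam' p Hl' [Hd1 Hd2] Hp. assert (Cp := proj1 Hp).
destruct (HKb p Cp) as [KA KB].
assert (HE := energy_nonneg p Cp).
assert (H1 : c * energy p <= (1 + C * m) * form P lam p p).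
{ specialize (HG p Hp). specialize (Hmass p Hp).
  assert (C * mass p <= C * (m * form P lam p p)) by (apply Rmult_le_compat_l; lra). lra. }
set (A := RInt (inertia P p p) 0 1) in *. set (B := RInt (dissipation P p p) 0 1) in *.
assert (Hq : form P lam' p p = form P lam p p - (lam - lam') * ((lam + lam') * A + B)).
{ rewrite !form_expand by assumption. fold A B. ring. }
apply Rabs_le_between in KA. apply Rabs_le_between in KB.
assert (H2 : (lam + lam') * A + B <= (2 * lam + 1) * K * energy p).
{ assert ((lam + lam') * A <= (2 * lam) * (K * energy p)); [| lra].
  apply Rle_trans with ((lam + lam') * (K * energy p)).
  - apply Rmult_le_compat_l; lra.
  - apply Rmult_le_compat_r; [nra | lra]. }
assert (H3 : (lam - lam') * S <= c).
{ replace c with (c / S * S) by (field; lra). apply Rmult_le_compat_r; lra. }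
assert (H4 : (lam - lam') * ((lam + lam') * A + B) <= (lam - lam') * ((2 * lam + 1) * K * energy p))
  by (apply Rmult_le_compat_l; lra).
assert (H5 : (lam - lam') * S * energy p <= c * energy p) by (apply Rmult_le_compat_r; lra).
apply Rmult_le_reg_l with (1 + C * m); [lra |]. rewrite Rmult_0_r, Hq.
assert (H6 : (1 + C * m) * ((lam - lam') * ((lam + lam') * A + B)) <=
  (1 + C * m) * ((lam - lam') * ((2 * lam + 1) * K * energy p)))
  by (apply Rmult_le_compat_l; lra).
unfold S in H5. lra.
Qed.

Theorem unstable_mode_exists (P : setting) : exists lam u, 0 < lam /\
  chain 4 u /\ mode_bc P u /\ (forall y, 0 <= y <= 1 -> mode_operator P lam u y = 0) /\
  (u 1%nat 0 <> 0 \/ u 3%nat 0 <> 0).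
Proof.
destruct (critical_rate P) as [lam [Hlam [Hpos Hcrit]]].
assert (Hmu := visc_pos P).
assert (Hlm : 0 < lam * visc P) by now apply Rmult_lt_0_compat.
assert (Hr := dens_cont P). assert (Hd := ddens_cont P).
(* Coefficients of the mode equation solved for the fourth derivative; the division by lam mu
   rescales the forcing, whence the factor in [M'] below. *)
set (a0 := fun y => - wave P ^ 4 - lam / visc P * wave P ^ 2 * dens P y
  + grav P * wave P ^ 2 / (lam * visc P) * ddens P y).
set (a1 := fun y => lam / visc P * ddens P y).
set (a2 := fun y => 2 * wave P ^ 2 + lam / visc P * dens P y).
assert (Hop : forall u f y,
  u 4%nat y = a0 y * u 0%nat y + a1 y * u 1%nat y + a2 y * u 2%nat y + / (lam * visc P) * f y ->
  mode_operator P lam u y = f y).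
{ intros u f y E. unfold mode_operator. rewrite E. unfold a0, a1, a2. field. lra. }
destruct (fredholm_alternative a0 a1 a2 (- slip0 P / visc P) (slip1 P / visc P))
  as [[u [[Cu Eu] [Bu Nu]]] | [M [HM HMi]]];
  [unfold a0; cont | unfold a1; cont | unfold a2; cont | |].
- exists lam, u. split; [assumption | split; [assumption | split; [assumption | split; [| assumption]]]].
  intros y Hy. apply (Hop u (fun _ => 0)). rewrite Eu by assumption. ring.
- exfalso.
  set (M' := M * (/ (lam * visc P)) ^ 2).
  assert (Hinv : 0 < / (lam * visc P)) by now apply Rinv_0_lt_compat.
  assert (HM' : 0 < M') by (apply Rmult_lt_0_compat; [assumption | now apply pow_lt]).
  assert (Hco := coercive_of_inverse P lam M' HM' Hpos).
  destruct (form_nonneg_nearby P lam ((1 + M') / 2)) as [d [Hd0 Hnear]]; [assumption | lra | |].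
  + apply Hco. intros f Cf.
    destruct (HMi (fun y => / (lam * visc P) * f y)) as [u [[Cu Eu] [Bu Iu]]]; [cont |].
    exists u. split; [assumption | split; [assumption | split]].
    * intros y Hy. apply Hop, Eu, Hy.
    * eapply Rle_trans; [exact Iu |]. right. unfold M'. rewrite Rmult_assoc. f_equal.
      rewrite <- cont_RInt_scal by cont. apply RInt_ext_01. intros; ring.
  + destruct (Hcrit d Hd0) as [lam' [p [Hl' [Hl'' [Hp Hn]]]]].
    assert (H := Hnear lam' p Hl' Hl'' Hp). lra.
Qed.

(** * Smooth profiles and Fourier modes *)

Lemma strip_loc (y : R) : 0 < y < 1 -> locally y (fun t => 0 < t < 1).
Proof. intros Hy; apply (open_and _ _ (open_gt 0) (open_lt 1)); exact Hy. Qed.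

(** C^n on (0,1) with every derivative continuously extendable to the closed interval. Derivatives
    are supplied as witnesses rather than through [Derive_n], so closure under sums and products is
    a direct induction. *)
Fixpoint smooth_upto (n : nat) (f : R -> R) : Prop :=
  (exists F, cont F /\ forall y, 0 < y < 1 -> f y = F y) /\
  match n with
  | O => True
  | S n => exists f', (forall y, 0 < y < 1 -> is_derive f y (f' y)) /\ smooth_upto n f'
  end.

Lemma smooth_upto_ext (n : nat) (f h : R -> R) : (forall y, 0 < y < 1 -> f y = h y) ->
  smooth_upto n f -> smooth_upto n h.
Proof.
intros E H. destruct n as [|n]; destruct H as [[F [CF EF]] H]; split.
- exists F; split; [assumption |]. intros y Hy; rewrite <- E; auto.
- trivial.
- exists F; split; [assumption |]. intros y Hy; rewrite <- E; auto.
- destruct H as [f' [Df Sf]]. exists f'; split; [| assumption].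
  intros y Hy. apply (is_derive_ext_loc f); [| now apply Df].
  apply (filter_imp (fun t => 0 < t < 1)); [exact E | now apply strip_loc].
Qed.

Lemma smooth_upto_S (n : nat) (f : R -> R) : smooth_upto (S n) f -> smooth_upto n f.
Proof.
revert f; induction n as [|n IH]; intros f [Hc [f' [Df Sf]]]; split; try assumption; trivial.
exists f'; split; [assumption | now apply IH].
Qed.

Lemma smooth_upto_cont (f : R -> R) : cont f -> smooth_upto 0 f.
Proof. intros Hf; split; [now exists f | trivial]. Qed.

Lemma smooth_upto_const (n : nat) (c : R) : smooth_upto n (fun _ => c).
Proof.
revert c; induction n as [|n IH]; intros c; split; trivial.
- exists (fun _ => c); split; [apply cont_const | trivial].
- exists (fun _ => c); split; [apply cont_const | trivial].
- exists (fun _ => 0); split; [intros; apply derive_const | apply IH].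
Qed.

Lemma smooth_upto_plus (n : nat) (f h : R -> R) :
  smooth_upto n f -> smooth_upto n h -> smooth_upto n (fun y => f y + h y).
Proof.
revert f h; induction n as [|n IH]; intros f h [[F [CF EF]] Hf] [[H [CH EH]] Hh]; split;
  try (exists (fun y => F y + H y); split; [cont | intros y Hy; rewrite EF, EH by assumption; reflexivity]);
  trivial.
destruct Hf as [f' [Df Sf]], Hh as [h' [Dh Sh]].
exists (fun y => f' y + h' y); split; [intros; apply derive_plus; auto | now apply IH].
Qed.

Lemma smooth_upto_mult (n : nat) (f h : R -> R) :
  smooth_upto n f -> smooth_upto n h -> smooth_upto n (fun y => f y * h y).
Proof.
revert f h; induction n as [|n IH]; intros f h Sf0 Sh0;
  assert (Sf := Sf0); assert (Sh := Sh0);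
  destruct Sf as [[F [CF EF]] Hf], Sh as [[H [CH EH]] Hh]; split;
  try (exists (fun y => F y * H y); split; [cont | intros y Hy; rewrite EF, EH by assumption; reflexivity]);
  trivial.
destruct Hf as [f' [Df Sf]], Hh as [h' [Dh Sh]].
exists (fun y => f' y * h y + f y * h' y); split; [intros; apply derive_mult; auto |].
apply smooth_upto_plus; apply IH; auto using smooth_upto_S.
Qed.

(** The one-sided limits at 0 and 1 glue each derivative to a continuous function on R. *)
Lemma smooth_upto_of_closed (f : R -> R) (n j : nat) :
  smooth_closed_interval f -> smooth_upto n (Derive_n f j).
Proof.
intros H; revert j.
assert (Dj : forall j y, 0 < y < 1 -> is_derive (Derive_n f j) y (Derive_n f (S j) y)).
{ intros j y Hy. apply Derive_correct. exact (proj1 (H (S j)) y Hy). }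
induction n as [|n IH]; intros j; split; trivial.
3: { exists (Derive_n f (S j)); split; [apply Dj | apply IH]. }
all: destruct (H j) as [_ [[l0 H0] [l1 H1]]];
  destruct (C0_extension_lt (Derive_n f j) l0 l1 0 1) as [F [CF [EF _]]]; try assumption;
  [lra | intros c Hc; apply (ex_derive_continuous (Derive_n f j)); eexists; now apply Dj |];
  exists F; split; [exact CF | intros y Hy; symmetry; now apply EF].
Qed.

Lemma Derive_n_S_comp (f : R -> R) (n : nat) (y : R) :
  Derive_n f (S n) y = Derive_n (Derive f) n y.
Proof.
change (Derive f) with (Derive_n f 1). rewrite Derive_n_comp.
now rewrite Nat.add_1_r.
Qed.

Lemma Derive_n_S_strip (f f' : R -> R) (n : nat) (y : R) :
  (forall t, 0 < t < 1 -> is_derive f t (f' t)) -> 0 < y < 1 ->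
  Derive_n f (S n) y = Derive_n f' n y.
Proof.
intros D Hy. rewrite Derive_n_S_comp. apply Derive_n_ext_loc.
apply (filter_imp (fun t => 0 < t < 1)); [| now apply strip_loc].
intros t Ht; now apply is_derive_unique, D.
Qed.

Lemma smooth_upto_Derive_n (n : nat) (f : R -> R) : smooth_upto n f ->
  (forall y, 0 < y < 1 -> ex_derive_n f n y) /\
  exists F, cont F /\ forall y, 0 < y < 1 -> Derive_n f n y = F y.
Proof.
revert f; induction n as [|n IH]; intros f [Hc H].
- split; [intros; exact I | exact Hc].
- destruct H as [f' [Df Sf]]. destruct (IH f' Sf) as [He [F [CF EF]]]. split.
  + intros y Hy. destruct n as [|n]; [exists (f' y); now apply Df |].
    apply (ex_derive_ext_loc (Derive_n f' n)); [| exact (He y Hy)].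
    apply (filter_imp (fun t => 0 < t < 1)); [| now apply strip_loc].
    intros t Ht; symmetry; now apply Derive_n_S_strip.
  + exists F; split; [assumption |]. intros y Hy.
    rewrite (Derive_n_S_strip f f') by assumption. now apply EF.
Qed.

Definition smooth01 (f : R -> R) : Prop := forall n, smooth_upto n f.

Lemma smooth01_plus (f h : R -> R) : smooth01 f -> smooth01 h -> smooth01 (fun y => f y + h y).
Proof. intros Hf Hh n; apply smooth_upto_plus; auto. Qed.

Lemma smooth01_mult (f h : R -> R) : smooth01 f -> smooth01 h -> smooth01 (fun y => f y * h y).
Proof. intros Hf Hh n; apply smooth_upto_mult; auto. Qed.

Lemma smooth01_const (c : R) : smooth01 (fun _ => c).
Proof. intros n; apply smooth_upto_const. Qed.

Lemma smooth01_ext (f h : R -> R) : (forall y, 0 < y < 1 -> f y = h y) ->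
  smooth01 f -> smooth01 h.
Proof. intros E H n; apply (smooth_upto_ext n f); auto. Qed.

(** Bootstrap: each of the first four functions gains a degree of smoothness from its successor, and
    the fourth derivative gains it through the equation. *)
Lemma smooth01_chain (a0 a1 a2 : R -> R) (u : nat -> R -> R) :
  smooth01 a0 -> smooth01 a1 -> smooth01 a2 -> chain 4 u ->
  (forall y, 0 < y < 1 -> u 4%nat y = a0 y * u 0%nat y + a1 y * u 1%nat y + a2 y * u 2%nat y) ->
  forall i, (i <= 4)%nat -> smooth01 (u i).
Proof.
intros S0 S1 S2 Cu Eu.
assert (H : forall n i, (i <= 4)%nat -> smooth_upto n (u i)).
{ induction n as [|n IH].
  - intros i Hi; apply smooth_upto_cont, (chain_cont 4); assumption.
  - assert (Hlt : forall i, (i < 4)%nat -> smooth_upto (S n) (u i)).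
    { intros i Hi; split.
      - exists (u i); split; [apply (chain_cont 4); [assumption | lia] | trivial].
      - exists (u (S i)); split; [intros; apply (proj1 Cu i Hi) | apply IH; lia]. }
    intros i Hi. destruct (Nat.eq_dec i 4) as [-> | Hn]; [| apply Hlt; lia].
    eapply smooth_upto_ext; [intros y Hy; symmetry; now apply Eu |].
    repeat apply smooth_upto_plus; apply smooth_upto_mult; auto; apply Hlt; lia. }
intros i Hi n; auto.
Qed.

(** Keeping both coefficients makes the family stable under differentiation in x and under
    multiplication by exp(lam t). *)
Definition trig (k a b x : R) : R := a * cos (k * x) + b * sin (k * x).

Definition field (k a b : R) (f : R -> R) (x y : R) : R := trig k a b x * f y.

Lemma trig_derive (k a b x : R) : is_derive (trig k a b) x (trig k (b * k) (- (a * k)) x).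
Proof. unfold trig; auto_derive; [trivial | ring]. Qed.

Lemma cont_trig (k a b : R) : cont (trig k a b).
Proof. apply (cont_derive _ _ (trig_derive k a b)). Qed.

Lemma Derive_n_trig (k : R) (m : nat) (a b : R) :
  exists a' b', forall x, Derive_n (trig k a b) m x = trig k a' b' x.
Proof.
revert a b; induction m as [|m IH]; intros a b; [now exists a, b |].
destruct (IH (b * k) (- (a * k))) as [a' [b' E]]. exists a', b'; intros x.
rewrite Derive_n_S_comp, <- E. apply Derive_n_ext. intros t.
apply is_derive_unique, trig_derive.
Qed.

Lemma cont_Derive_n_trig (k a b : R) (m : nat) : cont (Derive_n (trig k a b) m).
Proof.
destruct (Derive_n_trig k m a b) as [a' [b' E]]. intros x.
apply (continuous_ext (trig k a' b')); [intros t; now rewrite E | apply cont_trig].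
Qed.

(** Free of differentiability hypotheses: the total [Derive_n] commutes with constant factors
    everywhere. *)
Lemma partial_field (k a b : R) (f : R -> R) (m n : nat) (x y : R) :
  partial_derive m n (field k a b f) x y = Derive_n (trig k a b) m x * Derive_n f n y.
Proof.
unfold partial_derive, field.
rewrite (Derive_n_ext _ (fun t => trig k a b t * Derive_n f n y)).
- apply Derive_n_scal_r.
- intros t; apply Derive_n_scal_l.
Qed.

Lemma has_trace_product (F : R -> R -> R) (T G : R -> R) (x y : R) : cont T -> cont G ->
  (forall s t, 0 < t < 1 -> F s t = T s * G t) -> has_trace F x y (T x * G y).
Proof.
intros CT CG E. unfold has_trace.
apply (filterlim_ext_loc (fun p : R * R => T (fst p) * G (snd p))).
- exists (mkposreal 1 Rlt_0_1). intros [s t] _ Ht. simpl in *. symmetry; now apply E.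
- apply (filterlim_filter_le_1 (F := locally (x, y))); [apply filter_le_within |].
  apply (continuous_mult (fun p : R * R => T (fst p)) (fun p : R * R => G (snd p))).
  + apply (continuous_comp fst T); [apply continuous_fst | apply CT].
  + apply (continuous_comp snd G); [apply continuous_snd | apply CG].
Qed.

(** The induction runs over all coefficients and profiles: an x-derivative changes [a] and [b], a
    y-derivative replaces [f] by [Derive f]. *)
Lemma ex_diff_n_field (k : R) (n : nat) (a b : R) (f : R -> R) (x y : R) :
  (forall m t, 0 < t < 1 -> ex_derive_n f m t) -> 0 < y < 1 ->
  ex_diff_n (field k a b f) n x y.
Proof.
revert a b f; induction n as [|n IH]; intros a b f Hf Hy.
all: assert (C : continuity_2d_pt (field k a b f) x y).
1, 3: unfold field; apply continuity_2d_pt_mult;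
  [ apply (continuity_1d_2d_pt_comp (trig k a b) (fun s t => s));
    [apply continuity_pt_filterlim, cont_trig | apply continuity_2d_pt_id1]
  | apply (continuity_1d_2d_pt_comp f (fun s t => t));
    [apply continuity_pt_filterlim, (ex_derive_continuous f y), (Hf 1%nat y Hy)
    | apply continuity_2d_pt_id2] ].
- split; [assumption | exact I].
- split; [assumption | split; [| split; [| split]]].
  + unfold field. eexists. apply (derive_mult (trig k a b) (fun _ => f y));
      [apply trig_derive | apply derive_const].
  + unfold field. destruct (Hf 1%nat y Hy) as [l Hl].
    eexists. apply (derive_mult (fun _ => trig k a b x) f); [apply derive_const | exact Hl].
  + apply (ex_diff_n_ext_loc (field k (b * k) (- (a * k)) f)); [| now apply IH].
    exists (mkposreal 1 Rlt_0_1). intros s t _ _. unfold field.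
    rewrite Derive_scal_l. f_equal. symmetry; apply is_derive_unique, trig_derive.
  + apply (ex_diff_n_ext_loc (field k a b (Derive f))).
    * exists (mkposreal 1 Rlt_0_1). intros s t _ _. unfold field. now rewrite Derive_scal.
    * apply IH; [| assumption]. intros [|m] t Ht; [exact I |].
      apply (ex_derive_ext (Derive_n f (S m))); [intros z; apply Derive_n_S_comp |].
      exact (Hf (S (S m)) t Ht).
Qed.

Lemma smooth_strip_field (L a b : R) (f : R -> R) : 0 < L -> smooth01 f ->
  smooth_closed_strip L (field (/ L) a b f).
Proof.
intros HL Sf. split; [| split].
- intros x y _. unfold field, trig.
  replace (/ L * (x + 2 * PI * L)) with (/ L * x + 2 * PI) by (field; lra).
  rewrite cos_plus, sin_plus, cos_2PI, sin_2PI. ring.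
- intros n x y Hy. apply ex_diff_n_field; [| assumption].
  intros m t Ht. now apply (smooth_upto_Derive_n m f (Sf m)).
- intros m n x y Hy. destruct (smooth_upto_Derive_n n f (Sf n)) as [_ [G [CG EG]]].
  exists (Derive_n (trig (/ L) a b) m x * G y).
  apply has_trace_product; [apply cont_Derive_n_trig | assumption |].
  intros s t Ht. rewrite partial_field, EG by assumption. reflexivity.
Qed.

(** * Integrals over the strip and Sobolev norms of separated fields *)

Lemma integral_strip_product (L : R) (F : R -> R -> R) (T G : R -> R) : cont T -> cont G ->
  (forall x y, 0 < y < 1 -> F x y = T x * G y) ->
  integral_strip L F = RInt T 0 (2 * PI * L) * RInt G 0 1.
Proof.
intros CT CG E. unfold integral_strip.
rewrite (RInt_ext _ (fun x => RInt G 0 1 * T x)).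
- rewrite cont_RInt_scal by assumption. apply Rmult_comm.
- intros x _. rewrite (RInt_ext_01 _ (fun y => T x * G y)) by (intros y Hy; now apply E).
  rewrite cont_RInt_scal by assumption. apply Rmult_comm.
Qed.

Lemma field_scal (k e a b : R) (f : R -> R) (x y : R) :
  field k (e * a) (e * b) f x y = e * field k a b f x y.
Proof. unfold field, trig; ring. Qed.

Lemma Hk_term_field (L a b : R) (f : R -> R) (m n : nat) : smooth01 f ->
  exists G, cont G /\ (forall y, 0 < y < 1 -> Derive_n f n y = G y) /\
  integral_strip L (fun x y => partial_derive m n (field (/ L) a b f) x y ^ 2)
  = RInt (fun x => Derive_n (trig (/ L) a b) m x ^ 2) 0 (2 * PI * L)
    * RInt (fun y => G y ^ 2) 0 1.
Proof.
intros Sf. destruct (smooth_upto_Derive_n n f (Sf n)) as [_ [G [CG EG]]].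
exists G; split; [assumption | split; [assumption |]].
assert (CT := cont_Derive_n_trig (/ L) a b m).
apply integral_strip_product; [cont | cont |].
intros x y Hy. rewrite partial_field, EG by assumption. ring.
Qed.

Lemma Hk_term_nonneg (L a b : R) (f : R -> R) (m n : nat) : 0 < L -> smooth01 f ->
  0 <= integral_strip L (fun x y => partial_derive m n (field (/ L) a b f) x y ^ 2).
Proof.
intros HL Sf. destruct (Hk_term_field L a b f m n Sf) as [G [CG [_ ->]]].
assert (CT := cont_Derive_n_trig (/ L) a b m).
assert (HP := PI_RGT_0).
apply Rmult_le_pos; apply cont_RInt_ge_0; try (intros; apply pow2_ge_0); try lra; cont.
apply Rmult_le_pos; lra.
Qed.

Lemma sum_n_ge_first (u : nat -> R) (k : nat) : (forall n, 0 <= u n) -> u 0%nat <= sum_n u k.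
Proof.
intros H; induction k as [|k IH]; [rewrite sum_O; lra |].
rewrite sum_Sn. change (u 0%nat <= sum_n u k + u (S k)). specialize (H (S k)). lra.
Qed.

Lemma sum_n_scal (c : R) (u : nat -> R) (k : nat) : sum_n (fun n => c * u n) k = c * sum_n u k.
Proof. exact (sum_n_mult_l c u k). Qed.

(** The L^2 part is one term of a sum of nonnegative ones, so a single nonzero component makes every
    H^k norm positive. *)
Lemma Hk_norm_sq_ge_L2 (L a b : R) (f : R -> R) (k : nat) : 0 < L -> smooth01 f ->
  integral_strip L (fun x y => field (/ L) a b f x y ^ 2) <= Hk_norm_sq L k (field (/ L) a b f).
Proof.
intros HL Sf. unfold Hk_norm_sq.
set (I := fun m n => integral_strip L (fun x y => partial_derive m n (field (/ L) a b f) x y ^ 2)).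
change (I 0%nat 0%nat <= sum_n (fun m => sum_n (fun n => I m n) (k - m)) k).
assert (HI : forall m n, 0 <= I m n) by (intros; now apply Hk_term_nonneg).
apply Rle_trans with (sum_n (fun n => I 0%nat n) (k - 0)).
- apply (sum_n_ge_first (fun n => I 0%nat n)); auto.
- apply (sum_n_ge_first (fun m => sum_n (fun n => I m n) (k - m))).
  intros m. apply Rle_trans with (I m 0%nat); [auto |].
  apply (sum_n_ge_first (fun n => I m n)); auto.
Qed.

Lemma Hk_norm_sq_scal (L e a b : R) (f : R -> R) (k : nat) : smooth01 f ->
  Hk_norm_sq L k (field (/ L) (e * a) (e * b) f) = e ^ 2 * Hk_norm_sq L k (field (/ L) a b f).
Proof.
intros Sf. unfold Hk_norm_sq.
rewrite <- sum_n_scal. apply sum_n_ext. intros m.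
rewrite <- sum_n_scal. apply sum_n_ext. intros n.
destruct (smooth_upto_Derive_n n f (Sf n)) as [_ [G [CG EG]]].
assert (CT := cont_Derive_n_trig (/ L) a b m).
rewrite (integral_strip_product L _ (fun x => e ^ 2 * Derive_n (trig (/ L) a b) m x ^ 2)
  (fun y => G y ^ 2)); [| cont | cont |].
- rewrite (integral_strip_product L _ (fun x => Derive_n (trig (/ L) a b) m x ^ 2)
    (fun y => G y ^ 2)); [| cont | cont |].
  + rewrite cont_RInt_scal by cont. unfold mult; simpl. ring.
  + intros x y Hy. rewrite partial_field, EG by assumption. ring.
- intros x y Hy. rewrite partial_field, EG by assumption.
  rewrite (Derive_n_ext _ (fun t => e * trig (/ L) a b t)) by (intros; unfold trig; ring).
  rewrite Derive_n_scal_l. ring.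
Qed.

Lemma is_lim_exp_scal (lam c : R) : 0 < lam -> 0 < c ->
  is_lim (fun t => exp (lam * t) * c) p_infty p_infty.
Proof.
intros Hlam Hc. apply is_lim_spec. intros M. exists (M / (lam * c)). intros t Ht.
assert (Hlc : 0 < lam * c) by now apply Rmult_lt_0_compat.
apply (Rmult_lt_compat_r (lam * c)) in Ht; [| assumption].
replace (M / (lam * c) * (lam * c)) with M in Ht by (field; lra).
assert (H := exp_ineq1_le (lam * t)).
assert (lam * t * c <= exp (lam * t) * c) by (apply Rmult_le_compat_r; lra). lra.
Qed.

(** * The growing mode *)

(** The derivative is extended first and then integrated, which makes the extension C^1 across 0 and
    1; the constant matches the density at y = 1/2. *)
Lemma profile_extension (rhobar : R -> R) : smooth_closed_interval rhobar ->
  exists r r', cont r' /\ (forall y, is_derive r y (r' y)) /\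
    forall y, 0 < y < 1 -> r y = rhobar y /\ r' y = Derive rhobar y.
Proof.
intros H.
destruct (smooth_upto_of_closed rhobar 0 1 H) as [[r' [Cr' Er']] _].
assert (D : forall y, 0 < y < 1 -> is_derive rhobar y (r' y)).
{ intros y Hy. rewrite <- Er' by assumption. apply Derive_correct.
  exact (proj1 (H 1%nat) y Hy). }
exists (antideriv (rhobar (/ 2) - RInt r' 0 (/ 2)) r'), r'.
split; [assumption | split; [now apply antideriv_derive |]].
intros y Hy. split; [| now rewrite <- Er'].
unfold antideriv. rewrite <- (RInt_Chasles r' 0 (/ 2) y) by now apply cont_ex_RInt.
assert (E : RInt r' (/ 2) y = rhobar y - rhobar (/ 2)).
{ apply is_RInt_unique, (is_RInt_derive rhobar r').
  - intros x Hx. apply D. unfold Rmin, Rmax in Hx. destruct Rle_dec; lra.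
  - intros x _; apply Cr'. }
rewrite E. unfold plus; simpl. ring.
Qed.

Lemma lower_bound_closure (r : R -> R) (c : R) : cont r ->
  (forall y, 0 < y < 1 -> c <= r y) -> forall y, 0 <= y <= 1 -> c <= r y.
Proof.
intros Cr H y Hy. apply Rnot_lt_le. intros Hlt.
assert (Hloc : locally y (fun t => r t < c)).
{ apply (Cr y (fun z => z < c)). now apply open_lt. }
destruct Hloc as [d Hd]. assert (Hd0 := cond_pos d).
set (t := if Rle_dec y (/ 2) then y + Rmin (d / 2) (/ 4) else y - Rmin (d / 2) (/ 4)).
assert (Ht : 0 < t < 1 /\ Rabs (t - y) < d).
{ assert (0 < Rmin (d / 2) (/ 4) <= / 4 /\ Rmin (d / 2) (/ 4) <= d / 2)
    by (repeat split; [apply Rmin_glb_lt; lra | apply Rmin_r | apply Rmin_l]).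
  unfold t; destruct (Rle_dec y (/ 2)); (split; [lra | apply Rabs_def1; lra]). }
assert (H1 := Hd t (proj2 Ht)). assert (H2 := H t (proj1 Ht)). lra.
Qed.

Lemma Glb_pos_lower_bound (f : R -> R) :
  Rbar_lt 0 (Glb_Rbar (fun r => exists y, 0 < y < 1 /\ r = f y)) ->
  exists c, 0 < c /\ forall y, 0 < y < 1 -> c <= f y.
Proof.
set (E := fun r => exists y, 0 < y < 1 /\ r = f y).
destruct (Glb_Rbar_correct E) as [Hlb _].
assert (Hf : forall y, 0 < y < 1 -> Rbar_le (Glb_Rbar E) (f y)).
{ intros y Hy. apply Hlb. now exists y. }
destruct (Glb_Rbar E) as [c | |]; intros H.
- exists c; split; [exact H | exact Hf].
- destruct (Hf (/ 2)). lra.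
- destruct H.
Qed.

(** If u vanished on (0,1), so would its derivatives, and continuity at 0 would contradict the data
    left by the shooting argument. *)
Lemma mode_nontrivial (u : nat -> R -> R) : chain 4 u ->
  (u 1%nat 0 <> 0 \/ u 3%nat 0 <> 0) -> exists y, 0 < y < 1 /\ u 0%nat y <> 0.
Proof.
intros Cu Hnz.
destruct (classic (exists y, 0 < y < 1 /\ u 0%nat y <> 0)) as [H | Hno]; [assumption |].
exfalso.
assert (Z0 : forall y, 0 < y < 1 -> u 0%nat y = 0).
{ intros y Hy. destruct (Req_dec (u 0%nat y) 0) as [|Hy']; [assumption |]. destruct Hno; now exists y. }
assert (Zstep : forall i, (i < 4)%nat -> (forall y, 0 < y < 1 -> u i y = 0) ->
  forall y, 0 < y < 1 -> u (S i) y = 0).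
{ intros i Hi Z y Hy. rewrite <- (is_derive_unique _ _ _ (proj1 Cu i Hi y)).
  apply is_derive_unique. apply (is_derive_ext_loc (fun _ => 0)); [| apply derive_const].
  apply (filter_imp (fun t => 0 < t < 1)); [| now apply strip_loc].
  intros t Ht; symmetry; now apply Z. }
assert (Zend : forall i, (i <= 4)%nat -> (forall y, 0 < y < 1 -> u i y = 0) -> u i 0 = 0).
{ intros i Hi Z. assert (Ci := chain_cont 4 i u Cu Hi).
  assert (Ci' : cont (fun y => - u i y)) by cont.
  assert (H1 : 0 <= u i 0).
  { apply (lower_bound_closure (u i) 0 Ci); [| lra]. intros y Hy. rewrite Z by assumption; lra. }
  assert (H2 : 0 <= - u i 0).
  { apply (lower_bound_closure (fun y => - u i y) 0 Ci'); [| lra].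
    intros y Hy. rewrite Z by assumption; lra. }
  lra. }
assert (Z1 := Zstep 0%nat ltac:(lia) Z0). assert (Z2 := Zstep 1%nat ltac:(lia) Z1).
assert (Z3 := Zstep 2%nat ltac:(lia) Z2).
assert (E1 := Zend 1%nat ltac:(lia) Z1). assert (E3 := Zend 3%nat ltac:(lia) Z3).
destruct Hnz; contradiction.
Qed.

(** At a fixed time the mode is again a separated field. Equality of functions allows rewriting
    under traces, partial derivatives and norms. *)
Lemma exp_mode_field (lam k a b : R) (f : R -> R) (t : R) :
  exp_mode lam (field k a b f) t = field k (exp (lam * t) * a) (exp (lam * t) * b) f.
Proof.
apply functional_extensionality; intros x. apply functional_extensionality; intros y.
unfold exp_mode. now rewrite field_scal.
Qed.

Lemma exp_mode_time_derive (lam : R) (f : R -> R -> R) (x y t : R) :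
  is_derive (fun s => exp_mode lam f s x y) t (lam * exp_mode lam f t x y).
Proof.
unfold exp_mode. auto_derive; [trivial | ring].
Qed.

Lemma dx_field (k a b : R) (f : R -> R) (x y : R) :
  d_x (field k a b f) x y = trig k (b * k) (- (a * k)) x * f y.
Proof.
unfold d_x. rewrite partial_field. simpl. f_equal. apply is_derive_unique, trig_derive.
Qed.

Lemma dy_field (k a b : R) (f : R -> R) (l x y : R) : is_derive f y l ->
  d_y (field k a b f) x y = trig k a b x * l.
Proof.
intros D. unfold d_y. rewrite partial_field. simpl. f_equal. now apply is_derive_unique.
Qed.

Lemma laplacian_field (k a b : R) (f f' f'' : R -> R) (x y : R) :
  (forall t, is_derive f t (f' t)) -> (forall t, is_derive f' t (f'' t)) ->
  laplacian (field k a b f) x y = trig k a b x * (f'' y - k ^ 2 * f y).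
Proof.
intros D D'. unfold laplacian. rewrite !partial_field.
assert (E2 : Derive_n f 2 y = f'' y).
{ rewrite Derive_n_S_comp. simpl. rewrite (Derive_ext _ f') by (intros; now apply is_derive_unique).
  now apply is_derive_unique. }
assert (T2 : Derive_n (trig k a b) 2 x = - k ^ 2 * trig k a b x).
{ rewrite Derive_n_S_comp. simpl.
  rewrite (Derive_ext _ (trig k (b * k) (- (a * k)))) by (intros; apply is_derive_unique, trig_derive).
  rewrite (is_derive_unique _ _ _ (trig_derive k (b * k) (- (a * k)) x)). unfold trig; ring. }
rewrite E2, T2. simpl. ring.
Qed.

(** The amplitude forced by the first momentum equation when u_1 = - phi'/k sin kx and q is a
    multiple of cos kx. *)
Definition pressure (P : setting) (lam : R) (u : nat -> R -> R) (y : R) : R :=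
  / wave P ^ 2 * (visc P * (u 3%nat y - wave P ^ 2 * u 1%nat y)
                  - lam * dens P y * u 1%nat y).

Lemma pressure_derive (P : setting) (lam : R) (u : nat -> R -> R) (y : R) : chain 4 u ->
  is_derive (pressure P lam u) y (/ wave P ^ 2 * (visc P * (u 4%nat y - wave P ^ 2 * u 2%nat y)
    - lam * (ddens P y * u 1%nat y + dens P y * u 2%nat y))).
Proof.
intros Cu.
assert (D1 := proj1 Cu 1%nat ltac:(lia)). assert (D3 := proj1 Cu 3%nat ltac:(lia)).
assert (Dr := dens_derive P).
eapply is_derive_eq; [unfold pressure; derive | ring].
Qed.

Lemma mode_smooth (P : setting) (lam : R) (u : nat -> R -> R) : 0 < lam ->
  smooth01 (dens P) -> smooth01 (ddens P) -> chain 4 u ->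
  (forall y, 0 <= y <= 1 -> mode_operator P lam u y = 0) ->
  (forall i, (i <= 4)%nat -> smooth01 (u i)) /\ smooth01 (pressure P lam u).
Proof.
intros Hlam S S' Cu Eu. assert (Hmu := visc_pos P).
assert (Hu : forall i, (i <= 4)%nat -> smooth01 (u i)).
{ apply (smooth01_chain
    (fun y => - wave P ^ 4 + (- (lam / visc P * wave P ^ 2) * dens P y
      + grav P * wave P ^ 2 / (lam * visc P) * ddens P y))
    (fun y => lam / visc P * ddens P y)
    (fun y => 2 * wave P ^ 2 + lam / visc P * dens P y)); try assumption;
    repeat first [ apply smooth01_plus | apply smooth01_mult | apply smooth01_const | assumption ].
  intros y Hy. assert (E := Eu y ltac:(lra)). unfold mode_operator in E.
  apply (Rmult_eq_reg_l (lam * visc P)); [| apply Rmult_integral_contrapositive; lra].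
  field_simplify; [| lra]. field_simplify in E. lra. }
split; [assumption |].
apply (smooth01_ext (fun y => / wave P ^ 2 * (visc P * (u 3%nat y + - wave P ^ 2 * u 1%nat y)
  + - lam * (dens P y * u 1%nat y)))); [intros; unfold pressure; ring |].
assert (S1 := Hu 1%nat ltac:(lia)). assert (S3 := Hu 3%nat ltac:(lia)).
repeat first [ apply smooth01_plus | apply smooth01_mult | apply smooth01_const | assumption ].
Qed.

(** The density amplitude - rhobar' phi / lam comes from the mass equation, the horizontal velocity
    - L phi' sin(x/L) from incompressibility. *)
Lemma mode_solves (P : setting) (L lam : R) (rhobar : R -> R) (u : nat -> R -> R) :
  0 < L -> wave P = / L -> 0 < lam -> chain 4 u -> mode_bc P u ->
  (forall y, 0 <= y <= 1 -> mode_operator P lam u y = 0) ->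
  smooth01 (dens P) -> smooth01 (ddens P) ->
  (forall y, 0 < y < 1 -> dens P y = rhobar y /\ ddens P y = Derive rhobar y) ->
  linearized_solution L (visc P) (grav P) (slip0 P) (slip1 P) rhobar
    (exp_mode lam (field (/ L) (- / lam) 0 (fun y => ddens P y * u 0%nat y)))
    (exp_mode lam (field (/ L) 0 (- L) (u 1%nat)))
    (exp_mode lam (field (/ L) 1 0 (u 0%nat)))
    (exp_mode lam (field (/ L) 1 0 (pressure P lam u))).
Proof.
intros HL Hk Hlam Cu [Z0 [Z1 [B0 B1]]] Eu S S' Hrho.
destruct (mode_smooth P lam u Hlam S S' Cu Eu) as [Su Sp].
assert (Hmu := visc_pos P).
assert (D0 := proj1 Cu 0%nat ltac:(lia)). assert (D1 := proj1 Cu 1%nat ltac:(lia)).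
assert (D2 := proj1 Cu 2%nat ltac:(lia)). assert (D3 := proj1 Cu 3%nat ltac:(lia)).
assert (C1 := chain_cont 4 1 u Cu ltac:(lia)). assert (C2 := chain_cont 4 2 u Cu ltac:(lia)).
assert (C0 := chain_cont 4 0 u Cu ltac:(lia)).
constructor.
- intros t _. rewrite !exp_mode_field.
  split; [| split; [| split]]; apply smooth_strip_field; try assumption; try (apply Su; lia).
  apply smooth01_mult; [assumption | apply Su; lia].
- intros t x y _ _. repeat split; eexists; apply exp_mode_time_derive.
- intros t x y _ Hy. rewrite (is_derive_unique _ _ _ (exp_mode_time_derive _ _ x y t)).
  rewrite <- (proj2 (Hrho y Hy)). unfold exp_mode, field, trig. field. lra.
- intros t x y _ Hy. rewrite (is_derive_unique _ _ _ (exp_mode_time_derive _ _ x y t)).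
  rewrite <- (proj1 (Hrho y Hy)), !exp_mode_field, dx_field.
  rewrite (laplacian_field _ _ _ _ _ _ _ _ D1 D2).
  unfold field, trig, pressure. rewrite Hk. field. lra.
- intros t x y _ Hy. rewrite (is_derive_unique _ _ _ (exp_mode_time_derive _ _ x y t)).
  rewrite <- (proj1 (Hrho y Hy)), !exp_mode_field.
  rewrite (dy_field _ _ _ _ _ _ _ (pressure_derive P lam u y Cu)).
  rewrite (laplacian_field _ _ _ _ _ _ _ _ D0 D1).
  assert (E := Eu y ltac:(lra)). unfold mode_operator in E. rewrite Hk in *.
  unfold field, trig.
  set (e := exp (lam * t) * cos (/ L * x)).
  (* The factor lam k^2 turns the second momentum equation into [mode_operator] times the
     exponential and the cosine. *)
  apply (Rmult_eq_reg_l (lam * / L ^ 2)).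
  2: { apply Rgt_not_eq, Rmult_lt_0_compat; [assumption | apply Rinv_0_lt_compat, pow_lt; assumption]. }
  apply Rminus_diag_uniq.
  transitivity (e * (lam * visc P * (u 4%nat y - 2 * (/ L) ^ 2 * u 2%nat y + (/ L) ^ 4 * u 0%nat y)
    + lam ^ 2 * ((/ L) ^ 2 * dens P y * u 0%nat y - ddens P y * u 1%nat y
               - dens P y * u 2%nat y)
    - grav P * (/ L) ^ 2 * ddens P y * u 0%nat y)).
  + unfold e. field. lra.
  + rewrite E; ring.
- intros t x y _ Hy. rewrite !exp_mode_field, dx_field, (dy_field _ _ _ _ _ _ _ (D0 y)).
  unfold trig. field. lra.
- intros t x _. rewrite exp_mode_field.
  set (a := exp (lam * t) * 1). set (b := exp (lam * t) * 0).
  assert (Tr : forall z, has_trace (field (/ L) a b (u 0%nat)) x z (trig (/ L) a b x * u 0%nat z)).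
  { intros z. apply has_trace_product; [apply cont_trig | assumption | reflexivity]. }
  assert (T1 := Tr 1). assert (T0 := Tr 0). rewrite Z1, Rmult_0_r in T1.
  rewrite Z0, Rmult_0_r in T0. now split.
- intros t x _. rewrite exp_mode_field.
  set (T := trig (/ L) (exp (lam * t) * 0) (exp (lam * t) * - L)).
  assert (E : T x * (u 2%nat 1 - slip1 P / visc P * u 1%nat 1) = 0) by (rewrite B1; ring).
  (* The product lemma gives the trace as [T x] times the slip defect; transport along [E]
     identifies it with 0. *)
  apply (fun H => eq_ind _ (has_trace _ x 1) H _ E).
  apply (has_trace_product _ T (fun y => u 2%nat y - slip1 P / visc P * u 1%nat y));
    [apply cont_trig | cont |].
  intros s y _. rewrite (dy_field _ _ _ _ _ _ _ (D1 y)). unfold field, T. ring.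
- intros t x _. rewrite exp_mode_field.
  set (T := trig (/ L) (exp (lam * t) * 0) (exp (lam * t) * - L)).
  assert (E : T x * (u 2%nat 0 - - (slip0 P / visc P) * u 1%nat 0) = 0)
    by (rewrite B0; unfold Rdiv; ring).
  apply (fun H => eq_ind _ (has_trace _ x 0) H _ E).
  apply (has_trace_product _ T (fun y => u 2%nat y - - (slip0 P / visc P) * u 1%nat y));
    [apply cont_trig | cont |].
  intros s y _. rewrite (dy_field _ _ _ _ _ _ _ (D1 y)). unfold field, T. ring.
Qed.

Lemma zero_mean_field (L : R) (f : R -> R) : 0 < L -> smooth01 f ->
  zero_mean L (field (/ L) 1 0 f).
Proof.
intros HL Sf. destruct (Sf 0%nat) as [[F [CF EF]] _].
unfold zero_mean.
rewrite (integral_strip_product L _ (trig (/ L) 1 0) F); [| apply cont_trig | assumption |].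
- rewrite (FTC (trig (/ L) 0 L)).
  + unfold trig. replace (/ L * (2 * PI * L)) with (2 * PI) by (field; lra).
    rewrite sin_2PI, (Rmult_0_r (/ L)), sin_0. ring.
  + intros x. eapply is_derive_eq; [apply trig_derive |]. unfold trig. field. lra.
  + apply cont_trig.
- intros x y Hy. unfold field. now rewrite EF.
Qed.

Lemma field_L2_pos (L : R) (f : R -> R) : 0 < L -> cont f ->
  (exists y, 0 < y < 1 /\ f y <> 0) ->
  0 < integral_strip L (fun x y => field (/ L) 1 0 f x y ^ 2).
Proof.
intros HL Cf [y [Hy Hfy]]. assert (HP := PI_RGT_0). assert (CT := cont_trig (/ L) 1 0).
assert (HPL : 0 < PI * L) by now apply Rmult_lt_0_compat.
rewrite (integral_strip_product L _ (fun x => trig (/ L) 1 0 x ^ 2) (fun y => f y ^ 2));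
  [| cont | cont | intros; unfold field; ring].
apply Rmult_lt_0_compat.
(* The middle of the period is an interior point where the squared cosine is 1. *)
- apply (RInt_gt_0_at _ _ _ (PI * L)); [cont | intros; apply pow2_ge_0 | lra |].
  unfold trig. replace (/ L * (PI * L)) with PI by (field; lra). rewrite cos_PI. lra.
- apply (RInt_gt_0_at _ _ _ y); [cont | intros; apply pow2_ge_0 | assumption |].
  now apply pow2_gt_0.
Qed.

(** The norm is exactly exp(lam t) times its value for the amplitudes, which is positive through the
    third component, the vertical velocity. *)
Lemma Hk_norm_mode_lim (L lam : R) (k : nat) (a1 b1 a2 b2 a3 b3 a4 b4 : R)
  (f1 f2 f3 f4 : R -> R) : 0 < L -> 0 < lam ->
  smooth01 f1 -> smooth01 f2 -> smooth01 f3 -> smooth01 f4 ->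
  0 < integral_strip L (fun x y => field (/ L) a3 b3 f3 x y ^ 2) ->
  is_lim (fun t => Hk_norm L k
    (exp_mode lam (field (/ L) a1 b1 f1) t) (exp_mode lam (field (/ L) a2 b2 f2) t)
    (exp_mode lam (field (/ L) a3 b3 f3) t) (exp_mode lam (field (/ L) a4 b4 f4) t))
    p_infty p_infty.
Proof.
intros HL Hlam S1 S2 S3 S4 Hpos.
set (N := fun a b f => Hk_norm_sq L k (field (/ L) a b f)).
set (S := N a1 b1 f1 + N a2 b2 f2 + N a3 b3 f3 + N a4 b4 f4).
assert (HN : forall a b f, smooth01 f -> 0 <= N a b f).
{ intros a b f Sf. eapply Rle_trans; [| now apply Hk_norm_sq_ge_L2].
  exact (Hk_term_nonneg L a b f 0 0 HL Sf). }
assert (HS : 0 < S).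
{ assert (K1 := HN a1 b1 f1 S1). assert (K2 := HN a2 b2 f2 S2). assert (K4 := HN a4 b4 f4 S4).
  assert (K3 := Hk_norm_sq_ge_L2 L a3 b3 f3 k HL S3). fold (N a3 b3 f3) in K3. unfold S. lra. }
apply (is_lim_ext (fun t => exp (lam * t) * sqrt S)).
- intros t. unfold Hk_norm. rewrite !exp_mode_field, !Hk_norm_sq_scal by assumption.
  fold (N a1 b1 f1) (N a2 b2 f2) (N a3 b3 f3) (N a4 b4 f4).
  rewrite <- !Rmult_plus_distr_l. fold S.
  assert (He := exp_pos (lam * t)).
  rewrite sqrt_mult by (try apply pow2_ge_0; lra). rewrite sqrt_pow2 by lra. reflexivity.
- apply is_lim_exp_scal; [assumption | now apply sqrt_lt_R0].
Qed.

Theorem theorem1p1 (L mu g k0 k1 : R) (rhobar : R -> R)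
  (hL : 0 < L) (hmu : 0 < mu) (hg : 0 < g)
  (hsmooth : smooth_closed_interval rhobar)
  (hinf : Rbar_lt (Finite 0)
            (Glb_Rbar (fun r : R => exists y, 0 < y < 1 /\ r = rhobar y)))
  (hRT : exists y0, 0 < y0 < 1 /\ Derive rhobar y0 > 0) :
  exists (lambda : R) (rhot v1 v2 pt : R -> R -> R),
    0 < lambda /\
    zero_mean L pt /\
    linearized_solution L mu g k0 k1 rhobar
      (exp_mode lambda rhot) (exp_mode lambda v1)
      (exp_mode lambda v2) (exp_mode lambda pt) /\
    (forall k : nat,
       is_lim (fun t => Hk_norm L k
                 (exp_mode lambda rhot t) (exp_mode lambda v1 t)
                 (exp_mode lambda v2 t) (exp_mode lambda pt t))
         p_infty p_infty).
Proof.
destruct (profile_extension rhobar hsmooth) as [r [r' [Cr' [Dr Er]]]].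
assert (Hlow : exists c, 0 < c /\ forall y, 0 <= y <= 1 -> c <= r y).
{ destruct (Glb_pos_lower_bound rhobar hinf) as [c [Hc Hb]].
  exists c; split; [assumption |]. apply lower_bound_closure; [exact (cont_derive r r' Dr) |].
  intros y Hy. rewrite (proj1 (Er y Hy)). now apply Hb. }
assert (Hup : exists y0, 0 < y0 < 1 /\ 0 < r' y0).
{ destruct hRT as [y0 [Hy0 Hp]]. exists y0; split; [assumption |].
  now rewrite (proj2 (Er y0 Hy0)). }
(* 1/L is the smallest positive wave number compatible with the period 2 pi L. *)
set (P := {| visc := mu; wave := / L; grav := g; slip0 := k0; slip1 := k1;
  dens := r; ddens := r'; visc_pos := hmu; wave_pos := Rinv_0_lt_compat L hL; grav_pos := hg;
  dens_derive := Dr; ddens_cont := Cr'; dens_lower := Hlow; ddens_pos_somewhere := Hup |}).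
assert (S : smooth01 r).
{ apply (smooth01_ext rhobar); [intros y Hy; symmetry; apply Er, Hy |].
  intros n; exact (smooth_upto_of_closed rhobar n 0 hsmooth). }
assert (S' : smooth01 r').
{ apply (smooth01_ext (Derive_n rhobar 1)); [intros y Hy; symmetry; apply (Er y Hy) |].
  intros n; exact (smooth_upto_of_closed rhobar n 1 hsmooth). }
destruct (unstable_mode_exists P) as [lam [u [Hlam [Cu [Bu [Eu Nu]]]]]].
destruct (mode_smooth P lam u Hlam S S' Cu Eu) as [Su Sp].
exists lam, (field (/ L) (- / lam) 0 (fun y => r' y * u 0%nat y)),
  (field (/ L) 0 (- L) (u 1%nat)), (field (/ L) 1 0 (u 0%nat)),
  (field (/ L) 1 0 (pressure P lam u)).
split; [assumption | split; [now apply zero_mean_field | split]].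
- exact (mode_solves P L lam rhobar u hL eq_refl Hlam Cu Bu Eu S S' Er).
- intros k. apply Hk_norm_mode_lim; try assumption; try (apply Su; lia).
  + apply smooth01_mult; [assumption | apply Su; lia].
  + apply field_L2_pos; [assumption | apply (chain_cont 4); [assumption | lia] |].
    now apply mode_nontrivial.
Qed.
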